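(* Let $\mathcal{A}=\{a,b\}$ and let $F=\{\psi_0,\psi_1,\psi_2\}$ be the substitutions $\psi_0\colon a\mapsto aabba,\ b\mapsto b$; $\psi_1\colon a\mapsto aab,\ b\mapsto bba$; $\psi_2\colon a\mapsto a,\ b\mapsto bbaab$. Let $\alpha=\sum_{k\ge 0}\epsilon_k3^k\in\mathbb{Z}_3$ (with $\epsilon_k\in\{0,1,2\}$) be a non-degenerate $3$-adic integer and let $s_\alpha=(\epsilon_0,\epsilon_1,\epsilon_2,\dots)$. Then $$\check{H}^1(\Omega_{F,s_\alpha})\cong G_\alpha\oplus\mathbb{Z},$$ where $G_\alpha=\varinjlim(B_{\epsilon_n})$ is the direct limit of $\mathbb{Z}^2\xrightarrow{B_{\epsilon_0}}\mathbb{Z}^2\xrightarrow{B_{\epsilon_1}}\mathbb{Z}^2\xrightarrow{B_{\epsilon_2}}\cdots$ with $B_i=\begin{pmatrix}1&i\\0&3\end{pmatrix}$ for $i\in\{0,1,2\}$.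
   Context: A $3$-adic integer $\alpha$ with digits $\epsilon_0,\epsilon_1,\dots$ is degenerate if there is $N$ such that either $\epsilon_n=0$ for all $n\ge N$ or $\epsilon_n=2$ for all $n\ge N$; otherwise it is non-degenerate. Substitutions are extended to words by concatenation. For a finite set $F=\{\psi_0,\psi_1,\psi_2\}$ of substitutions on $\mathcal{A}$ and $s=(s_0,s_1,\dots)\in\{0,1,2\}^{\mathbb{N}}$, write $\psi_{s[0,n]}=\psi_{s_0}\circ\psi_{s_1}\circ\cdots\circ\psi_{s_n}$. A bi-infinite sequence in $\mathcal{A}^{\mathbb{Z}}$ is admitted by $(F,s)$ if each of its finite subwords is a subword of $\psi_{s[0,n]}(c)$ for some $n\ge 0$ and some $c\in\mathcal{A}$. $\Sigma_{F,s}\subset\mathcal{A}^{\mathbb{Z}}$ is the space of admitted sequences (with the subspace topology from the product topology), which is invariant under the left shift $\sigma$. The tiling space is $\Omega_{F,s}=(\Sigma_{F,s}\times[0,1])/{\sim}$ with $(\mathcal{T},1)\sim(\sigma(\mathcal{T}),0)$. Čech cohomology is taken with integer coefficients. *)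

(* Defs.v *)
From HB Require Import structures.
From Stdlib Require Import Relation_Operators.
From mathcomp Require Import all_boot all_order all_algebra.
From mathcomp Require Import all_classical all_reals all_analysis.
From mathcomp Require Import ring.

Set Implicit Arguments.
Unset Strict Implicit.
Unset Printing Implicit Defensive.

Import Order.TTheory GRing.Theory Num.Theory.
Import numFieldNormedType.Exports.

Local Open Scope classical_set_scope.
Local Open Scope ring_scope.
Local Open Scope quotient_scope.

Record dirsys := Dirsys {
  ds_idx : choiceType ;
  ds_idx0 : ds_idx ;
  ds_le : ds_idx -> ds_idx -> Prop ;
  ds_le_refl : forall i, ds_le i i ;
  ds_le_trans : forall i j k, ds_le i j -> ds_le j k -> ds_le i k ;
  ds_directed : forall i j, exists k, ds_le i k /\ ds_le j k ;
  ds_grp : ds_idx -> zmodType ;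
  ds_map : forall i j, ds_le i j -> {additive ds_grp i -> ds_grp j} ;
  ds_map_id : forall i (h : ds_le i i) x, ds_map h x = x ;
  ds_map_comp : forall i j k (hij : ds_le i j) (hjk : ds_le j k)
    (hik : ds_le i k) x, ds_map hjk (ds_map hij x) = ds_map hik x }.

Section DirectLimit.
Context (D : dirsys).

Definition dirlim_pre := {i : ds_idx D & ds_grp i}.
HB.instance Definition _ := Choice.on dirlim_pre.

Definition dirlim_mk (i : ds_idx D) (x : ds_grp i) : dirlim_pre :=
  Tagged (@ds_grp D) x.

Definition dirlim_rel (x y : dirlim_pre) : bool :=
  `[< exists k (hx : ds_le (tag x) k) (hy : ds_le (tag y) k),
        ds_map hx (tagged x) = ds_map hy (tagged y) >].

Lemma dirlim_rel_equiv : equiv_class_of dirlim_rel.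
Proof.
split.
- by move=> x; apply/asboolP; exists (tag x), (ds_le_refl _), (ds_le_refl _).
- have sym x y : dirlim_rel x y -> dirlim_rel y x.
    by move=> /asboolP[k [hx [hy e]]]; apply/asboolP; exists k, hy, hx.
  by move=> x y; apply/idP/idP; exact: sym.
- move=> y x z /asboolP[k [hx [hy e]]] /asboolP[l [hy' [hz e']]].
  have [m [km lm]] := ds_directed k l; apply/asboolP.
  exists m, (ds_le_trans hx km), (ds_le_trans hz lm).
  rewrite -(ds_map_comp hx km) e (ds_map_comp hy km (ds_le_trans hy km)).
  by rewrite -(ds_map_comp hz lm) -e' (ds_map_comp hy' lm (ds_le_trans hy km)).
Qed.

Canonical dirlim_equiv := EquivRelPack dirlim_rel_equiv.

Definition dirlim := {eq_quot dirlim_rel}.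
HB.instance Definition _ := Choice.on dirlim.
HB.instance Definition _ := EqQuotient.on dirlim.

Definition dirlim_pi (i : ds_idx D) (x : ds_grp i) : dirlim :=
  \pi_dirlim (dirlim_mk x).

Lemma dirlim_piP i j (x : ds_grp i) (y : ds_grp j) :
  dirlim_pi x = dirlim_pi y <->
  exists k (hi : ds_le i k) (hj : ds_le j k), ds_map hi x = ds_map hj y.
Proof.
split; first by move=> /eqquotP /asboolP.
by move=> h; apply/eqquotP/asboolP.
Qed.

Lemma dirlim_pi_map i j (h : ds_le i j) (x : ds_grp i) :
  dirlim_pi (ds_map h x) = dirlim_pi x.
Proof.
apply/dirlim_piP; exists j, (ds_le_refl _), h.
by rewrite ds_map_id.
Qed.

Lemma dirlim_surj (u : dirlim) : exists i (x : ds_grp i), u = dirlim_pi x.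
Proof.
rewrite -[u]reprK; case: (repr u) => i x; by exists i, x.
Qed.

Definition dirlim_ub (i j : ds_idx D) : ds_idx D := projT1 (cid (ds_directed i j)).

Lemma dirlim_ubl i j : ds_le i (dirlim_ub i j).
Proof. by rewrite /dirlim_ub; case: cid => k []. Qed.

Lemma dirlim_ubr i j : ds_le j (dirlim_ub i j).
Proof. by rewrite /dirlim_ub; case: cid => k []. Qed.

Definition dirlim_zero : dirlim := dirlim_pi (0 : ds_grp (ds_idx0 D)).

Definition dirlim_opp (u : dirlim) : dirlim := dirlim_pi (- tagged (repr u)).

Definition dirlim_add (u v : dirlim) : dirlim :=
  dirlim_pi (ds_map (dirlim_ubl (tag (repr u)) (tag (repr v))) (tagged (repr u))
           + ds_map (dirlim_ubr (tag (repr u)) (tag (repr v))) (tagged (repr v))).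

Lemma dirlim_zeroE i : dirlim_zero = dirlim_pi (0 : ds_grp i).
Proof.
apply/dirlim_piP; have [k [h h']] := ds_directed (ds_idx0 D) i.
by exists k, h, h'; rewrite !raddf0.
Qed.

Lemma dirlim_repr i (x : ds_grp i) :
  dirlim_pi (tagged (repr (dirlim_pi x))) = dirlim_pi x.
Proof.
rewrite -[RHS]reprK /dirlim_pi /dirlim_mk; congr (\pi_dirlim _).
by case: (repr _).
Qed.

Lemma dirlim_oppE i (x : ds_grp i) : dirlim_opp (dirlim_pi x) = dirlim_pi (- x).
Proof.
rewrite /dirlim_opp; have /dirlim_piP[k [h [h' e]]] := dirlim_repr x.
by apply/dirlim_piP; exists k, h, h'; rewrite !raddfN e.
Qed.

Lemma dirlim_addE i (x y : ds_grp i) :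
  dirlim_add (dirlim_pi x) (dirlim_pi y) = dirlim_pi (x + y).
Proof.
rewrite /dirlim_add; have /dirlim_piP[k [h [h' e]]] := dirlim_repr x.
have /dirlim_piP[l [g [g' e']]] := dirlim_repr y.
set p := dirlim_ubl _ _; set q := dirlim_ubr _ _.
have [m [km lm]] := ds_directed k l.
have [n [mn un]] := ds_directed m
  (dirlim_ub (tag (repr (dirlim_pi x))) (tag (repr (dirlim_pi y)))).
have kn := ds_le_trans km mn; have ln := ds_le_trans lm mn.
have hin := ds_le_trans h' kn.
apply/dirlim_piP; exists n, un, hin; rewrite !raddfD /=.
congr (_ + _).
  by rewrite (ds_map_comp p un (ds_le_trans h kn)) -(ds_map_comp h kn) e
             (ds_map_comp h' kn hin).
by rewrite (ds_map_comp q un (ds_le_trans g ln)) -(ds_map_comp g ln) e'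
           (ds_map_comp g' ln hin).
Qed.

Lemma dirlim_surj2 (u v : dirlim) :
  exists i (x y : ds_grp i), u = dirlim_pi x /\ v = dirlim_pi y.
Proof.
have [i [x ->]] := dirlim_surj u; have [j [y ->]] := dirlim_surj v.
have [k [h h']] := ds_directed i j.
by exists k, (ds_map h x), (ds_map h' y); rewrite !dirlim_pi_map.
Qed.

Lemma dirlim_addA : associative dirlim_add.
Proof.
move=> u v w; have [i [x [y [-> ->]]]] := dirlim_surj2 u v.
have [j [z ->]] := dirlim_surj w; have [k [h h']] := ds_directed i j.
rewrite -(dirlim_pi_map h x) -(dirlim_pi_map h y) -(dirlim_pi_map h' z).
by rewrite !dirlim_addE addrA.
Qed.

Lemma dirlim_addC : commutative dirlim_add.
Proof.
move=> u v; have [i [x [y [-> ->]]]] := dirlim_surj2 u v.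
by rewrite !dirlim_addE addrC.
Qed.

Lemma dirlim_add0 : left_id dirlim_zero dirlim_add.
Proof.
move=> u; have [i [x ->]] := dirlim_surj u.
by rewrite (dirlim_zeroE i) dirlim_addE add0r.
Qed.

Lemma dirlim_addN : left_inverse dirlim_zero dirlim_opp dirlim_add.
Proof.
move=> u; have [i [x ->]] := dirlim_surj u.
by rewrite (dirlim_zeroE i) dirlim_oppE dirlim_addE addNr.
Qed.

HB.instance Definition _ := GRing.isZmodule.Build dirlim
  dirlim_addA dirlim_addC dirlim_add0 dirlim_addN.

End DirectLimit.

Section SequentialLimit.
Context (V : zmodType) (f : nat -> {additive V -> V}).

(* [seqlim_map i j] is [f (j-1) \o ... \o f (i+1) \o f i] for [i <= j] *)
Definition seqlim_map (i j : nat) (x : V) : V :=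
  foldl (fun y k => f k y) x (iota i (j - i)%N).

Lemma seqlim_map_additive i j : zmod_morphism (seqlim_map i j).
Proof.
rewrite /seqlim_map => x y; elim: (iota _ _) x y => //= k l IH x y.
by rewrite raddfB IH.
Qed.

HB.instance Definition _ i j :=
  GRing.isZmodMorphism.Build V V (seqlim_map i j) (seqlim_map_additive i j).

Lemma seqlim_map_id i (h : (i <= i)%N) x : seqlim_map i i x = x.
Proof. by rewrite /seqlim_map subnn. Qed.

Lemma seqlim_map_comp i j k (hij : (i <= j)%N) (hjk : (j <= k)%N)
  (hik : (i <= k)%N) x : seqlim_map j k (seqlim_map i j x) = seqlim_map i k x.
Proof.
rewrite /seqlim_map -foldl_cat -{2}(subnKC hij) -iotaD.
by rewrite addnC addnBA // subnK.
Qed.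

Lemma leq_directed (i j : nat) : exists k, (i <= k)%N /\ (j <= k)%N.
Proof. by exists (maxn i j); rewrite leq_maxl leq_maxr. Qed.

Definition seq_dirsys : dirsys :=
  @Dirsys nat 0%N (fun i j => (i <= j)%N) leqnn
    (fun i j k hij hjk => leq_trans hij hjk) leq_directed (fun=> V)
    (fun i j _ => seqlim_map i j) seqlim_map_id seqlim_map_comp.

Definition seqlim : zmodType := dirlim seq_dirsys.

End SequentialLimit.

Section Cech.
Context (X : topologicalType).

Record open_cover := OpenCover {
  cover_sets :> set (set X) ;
  cover_open : forall u, cover_sets u -> open u ;
  cover_full : \bigcup_(u in cover_sets) u = [set: X] }.

HB.instance Definition _ := gen_eqMixin open_cover.
HB.instance Definition _ := gen_choiceMixin open_cover.

Definition member (U : open_cover) : Type := set_type (cover_sets U).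

Definition mem_set_of (U : open_cover) (u : member U) : set X := \val u.

Section Cochains.
Context (U : open_cover).

Definition cochain1 := member U -> member U -> int.
HB.instance Definition _ := GRing.Zmodule.on cochain1.

(* A 1-cochain of the nerve is extended by 0 to the pairs (u, v) that do not
   span a simplex, i.e. those with empty intersection. *)
Definition cocycle1 (f : cochain1) : bool :=
  `[< (forall u v, mem_set_of u `&` mem_set_of v = set0 -> f u v = 0) /\
      (forall u v w,
         mem_set_of u `&` mem_set_of v `&` mem_set_of w !=set0 ->
         f v w - f u w + f u v = 0) >].

Lemma cocycle1_zmod : zmod_closed cocycle1.
Proof.
split.
  by apply/asboolP; split=> [u v _|u v w _] //; rewrite /= !addr0 subr0.
move=> f g /asboolP[f0 fc] /asboolP[g0 gc]; apply/asboolP; split=> [u v e|].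
  by rewrite !fctE /= f0 // g0 // subr0.
move=> u v w ne; have := fc u v w ne; have := gc u v w ne.
rewrite !fctE /= => eg ef.
have -> : forall a b c a' b' c' : int,
  a - a' - (b - b') + (c - c') = (a - b + c) - (a' - b' + c') by move=> *; ring.
by rewrite eg ef subr0.
Qed.

HB.instance Definition _ :=
  GRing.isZmodClosed.Build cochain1 cocycle1 cocycle1_zmod.

Record cech_Z1 := CechZ1 { cech_Z1_val : cochain1 ; _ : cocycle1 cech_Z1_val }.
HB.instance Definition _ := [isSub for cech_Z1_val].
HB.instance Definition _ := [Choice of cech_Z1 by <:].
HB.instance Definition _ := [SubChoice_isSubZmodule of cech_Z1 by <:].

Definition coboundary1 (f : cech_Z1) : bool :=
  `[< exists g : member U -> int, forall u v,
        mem_set_of u `&` mem_set_of v !=set0 ->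
        cech_Z1_val f u v = g v - g u >].

Lemma coboundary1_zmod : zmod_closed coboundary1.
Proof.
split.
  by apply/asboolP; exists (fun=> 0) => u v _; rewrite subr0.
move=> f f' /asboolP[g hg] /asboolP[g' hg'].
apply/asboolP; exists (fun u => g u - g' u) => u v ne.
have -> : cech_Z1_val (f - f') = cech_Z1_val f - cech_Z1_val f'.
  exact: (raddfB (\val : cech_Z1 -> cochain1)).
by rewrite !fctE /= hg // hg' //; ring.
Qed.

HB.instance Definition _ :=
  GRing.isZmodClosed.Build cech_Z1 coboundary1 coboundary1_zmod.

Definition cech_B1 : zmodClosed cech_Z1 :=
  GRing.ZmodClosed.clone cech_Z1 coboundary1 _.

Definition cech_H1_cover : zmodType := Quotient.quot cech_B1.

End Cochains.

Definition refines (U V : open_cover) : Prop :=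
  forall v : member V, exists u : member U, mem_set_of v `<=` mem_set_of u.

Definition is_refinement (U V : open_cover) (r : member V -> member U) : Prop :=
  forall v, mem_set_of v `<=` mem_set_of (r v).

Section Pullback.
Context (U V : open_cover) (r : member V -> member U) (hr : is_refinement r).

Definition pullback1 (f : cochain1 U) : cochain1 V := fun v w =>
  if `[< mem_set_of v `&` mem_set_of w !=set0 >] then f (r v) (r w) else 0.

Lemma pullback1_cocycle (f : cochain1 U) : cocycle1 f -> cocycle1 (pullback1 f).
Proof.
move=> /asboolP[f0 fc]; apply/asboolP; split=> [v w e|u v w [x [[xu xv] xw]]].
  by rewrite /pullback1 asboolF // e => -[].
rewrite /pullback1 !asboolT; [|by exists x..].
by apply: fc; exists x; split; [split|]; exact: hr.
Qed.

Definition pullback_Z1 (f : cech_Z1 U) : cech_Z1 V :=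
  CechZ1 (pullback1_cocycle (valP f)).

Lemma pullback_Z1E (f : cech_Z1 U) v w :
  mem_set_of v `&` mem_set_of w !=set0 ->
  cech_Z1_val (pullback_Z1 f) v w = cech_Z1_val f (r v) (r w).
Proof. by move=> ne; rewrite /= /pullback1 asboolT. Qed.

Lemma refinement_meet v w : mem_set_of v `&` mem_set_of w !=set0 ->
  mem_set_of (r v) `&` mem_set_of (r w) !=set0.
Proof. by case=> x [xv xw]; exists x; split; exact: hr. Qed.

End Pullback.

Lemma cech_Z1_valB (U : open_cover) (f g : cech_Z1 U) u v :
  cech_Z1_val (f - g) u v = cech_Z1_val f u v - cech_Z1_val g u v.
Proof.
have -> // : cech_Z1_val (f - g) = cech_Z1_val f - cech_Z1_val g.
exact: (raddfB (\val : cech_Z1 U -> cochain1 U)).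
Qed.

Definition cech_class (U : open_cover) (f : cech_Z1 U) : cech_H1_cover U :=
  \pi_(Quotient.quot (cech_B1 U)) f.

Lemma cech_class_additive U : zmod_morphism (@cech_class U).
Proof. by move=> f g; rewrite /cech_class raddfB. Qed.

HB.instance Definition _ U := GRing.isZmodMorphism.Build
  (cech_Z1 U) (cech_H1_cover U) (@cech_class U) (@cech_class_additive U).

Lemma cech_classP (U : open_cover) (f g : cech_Z1 U) :
  cech_class f = cech_class g <-> coboundary1 (f - g).
Proof.
split.
  move=> /eqP; rewrite /cech_class -Quotient.idealrBE.
  by [].
by move=> h; apply/eqP; rewrite /cech_class -Quotient.idealrBE.
Qed.

Lemma cech_class_repr (U : open_cover) (c : cech_H1_cover U) :
  cech_class (repr c) = c.
Proof. exact: reprK. Qed.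

Lemma pullback_indep (U V : open_cover) (r r' : member V -> member U)
  (hr : is_refinement r) (hr' : is_refinement r') (f g : cech_Z1 U) :
  cech_class f = cech_class g ->
  cech_class (pullback_Z1 hr f) = cech_class (pullback_Z1 hr' g).
Proof.
move=> /cech_classP/asboolP[h fg]; apply/cech_classP/asboolP.
exists (fun v => h (r v) - cech_Z1_val g (r v) (r' v)) => v w ne.
rewrite cech_Z1_valB !pullback_Z1E //.
have := fg _ _ (refinement_meet hr ne); rewrite cech_Z1_valB => /eqP.
rewrite subr_eq => /eqP ->.
have /asboolP[_ gc] := valP g; case: ne => x [xv xw].
have xr := hr _ _ xv; have xr' := hr' _ _ xv.
have yr := hr _ _ xw; have yr' := hr' _ _ xw.
have /= e1 : _ = 0 := gc (r v) (r w) (r' w) (ex_intro _ x (conj (conj xr yr) yr')).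
have /= e2 : _ = 0 := gc (r v) (r' v) (r' w) (ex_intro _ x (conj (conj xr xr') yr')).
move: e1 e2.
set p := cech_Z1_val g (r v) (r w); set q := cech_Z1_val g (r w) (r' w).
set t := cech_Z1_val g (r v) (r' w); set y := cech_Z1_val g (r' v) (r' w).
set z := cech_Z1_val g (r v) (r' v) => e1 e2.
have -> : p = t - q by move/eqP: e1; rewrite addrC addr_eq0 opprB => /eqP.
have -> : y = t - z by move/eqP: e2; rewrite -addrA addr_eq0 => /eqP ->; ring.
ring.
Qed.

Section RefinementMap.
Context (U V : open_cover) (h : refines U V).

Definition refinement (v : member V) : member U := projT1 (cid (h v)).

Lemma refinementP : is_refinement refinement.
Proof. by move=> v; rewrite /refinement; case: cid. Qed.

Definition cech_H1_map (c : cech_H1_cover U) : cech_H1_cover V :=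
  cech_class (pullback_Z1 refinementP (repr c)).

Lemma cech_H1_mapE (r : member V -> member U) (hr : is_refinement r)
  (f : cech_Z1 U) :
  cech_H1_map (cech_class f) = cech_class (pullback_Z1 hr f).
Proof. by apply: pullback_indep; rewrite cech_class_repr. Qed.

Lemma cech_H1_map_additive : zmod_morphism cech_H1_map.
Proof.
move=> c d; rewrite -[c]cech_class_repr -[d]cech_class_repr -raddfB.
rewrite !(cech_H1_mapE refinementP) -raddfB; congr cech_class.
apply/val_inj/funext => v; apply/funext => w.
rewrite [RHS]cech_Z1_valB /= /pullback1; case: ifP => _; last by rewrite subr0.
by rewrite -cech_Z1_valB.
Qed.

HB.instance Definition _ := GRing.isZmodMorphism.Build
  (cech_H1_cover U) (cech_H1_cover V) cech_H1_map cech_H1_map_additive.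

End RefinementMap.

Lemma refines_refl U : refines U U.
Proof. by move=> u; exists u. Qed.

Lemma refines_trans U V W : refines U V -> refines V W -> refines U W.
Proof.
move=> hUV hVW w; have [v wv] := hVW w; have [u vu] := hUV v.
by exists u; exact: subset_trans wv vu.
Qed.

Lemma cech_H1_map_id U (h : refines U U) c : cech_H1_map h c = c.
Proof.
have hid : is_refinement (@id (member U)) by move=> u.
rewrite -{1}[c]cech_class_repr (cech_H1_mapE h hid) -[RHS]cech_class_repr.
apply/cech_classP/asboolP; exists (fun=> 0) => u v ne.
by rewrite cech_Z1_valB pullback_Z1E // !subrr.
Qed.

Lemma cech_H1_map_comp U V W (hUV : refines U V) (hVW : refines V W)
  (hUW : refines U W) c :
  cech_H1_map hVW (cech_H1_map hUV c) = cech_H1_map hUW c.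
Proof.
have hc : is_refinement (refinement hUV \o refinement hVW).
  by move=> w x xw; apply: (refinementP hUV); exact: (refinementP hVW).
rewrite -[c]cech_class_repr (cech_H1_mapE hUW hc) (cech_H1_mapE _ (refinementP hUV)).
rewrite (cech_H1_mapE _ (refinementP hVW)).
apply/cech_classP/asboolP; exists (fun=> 0) => u v ne.
rewrite cech_Z1_valB !pullback_Z1E // ?subrr //.
exact: (refinement_meet (refinementP hVW)).
Qed.

Definition trivial_cover : open_cover.
Proof.
exists [set setT]; first by move=> u ->; exact: openT.
by rewrite bigcup_set1.
Defined.

Definition inter_cover (U V : open_cover) : open_cover.
Proof.
exists [set w | exists u v, [/\ cover_sets U u, cover_sets V v & w = u `&` v]].
  by move=> _ [u [v [Uu Vv ->]]]; apply: openI; [exact: cover_open Uu|exact: cover_open Vv].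
apply/seteqP; split=> // x _.
have [u Uu xu] : (\bigcup_(u in U) u) x by rewrite cover_full.
have [v Vv xv] : (\bigcup_(v in V) v) x by rewrite cover_full.
by exists (u `&` v) => //; exists u, v.
Defined.

Lemma refines_directed U V : exists W, refines U W /\ refines V W.
Proof.
exists (inter_cover U V); split=> -[w /[dup] /set_mem[u [v [Uu Vv e]]] wU].
  by exists (exist _ u (mem_set Uu)); rewrite /mem_set_of /= e; exact: subIsetl.
by exists (exist _ v (mem_set Vv)); rewrite /mem_set_of /= e; exact: subIsetr.
Qed.

Definition cech_dirsys : dirsys :=
  @Dirsys open_cover trivial_cover refines refines_refl refines_trans
    refines_directed cech_H1_cover
    (fun U V h => cech_H1_map h) cech_H1_map_id cech_H1_map_comp.

Definition cech_H1 : zmodType := dirlim cech_dirsys.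

End Cech.

Definition zmod_isomorphic (G H : zmodType) : Prop :=
  exists f : {additive G -> H}, bijective f.

Definition subst (A : Type) := A -> seq A.

Definition subst_word (A : Type) (psi : subst A) (w : seq A) : seq A :=
  flatten (map psi w).

Definition subst_comp (A : Type) (psi phi : subst A) : subst A :=
  fun c => subst_word psi (phi c).

(* [subst_range F s n] is psi_{s_0} o psi_{s_1} o ... o psi_{s_n} *)
Fixpoint subst_range (I A : Type) (F : I -> subst A) (s : nat -> I) (n : nat)
    : subst A :=
  if n is m.+1 then subst_comp (subst_range F s m) (F (s m.+1)) else F (s 0%N).

Definition full_shift (A : choiceType) : topologicalType :=
  prod_topology (fun _ : int => discrete_topology A).

Definition shift (A : choiceType) (T : full_shift A) : full_shift A :=
  fun i => T (i + 1).

(* T_i T_{i+1} ... T_{i+l-1} *)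
Definition subword (A : choiceType) (T : full_shift A) (i : int) (l : nat)
    : seq A :=
  mkseq (fun k => T (i + k%:Z)) l.

Definition admitted_space (I : Type) (A : choiceType) (F : I -> subst A)
    (s : nat -> I) : set (full_shift A) :=
  [set T | forall i l, exists n c, infix (subword T i l) (subst_range F s n c)].

Lemma admitted_shift (I : Type) (A : choiceType) (F : I -> subst A)
  (s : nat -> I) (T : full_shift A) :
  admitted_space F s T -> admitted_space F s (shift T).
Proof.
move=> hT i l; have [n [c h]] := hT (i + 1) l; exists n, c.
suff -> : subword (shift T) i l = subword T (i + 1) l by [].
by apply: eq_mkseq => k; rewrite /shift addrAC.
Qed.

Section TilingSpace.
Context (R : realType) (I : Type) (A : choiceType).
Context (F : I -> subst A) (s : nat -> I).

Definition sigma_space : topologicalType := set_type (admitted_space F s).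

Definition sigma_shift (T : sigma_space) : sigma_space :=
  exist _ (shift (\val T)) (mem_set (admitted_shift (set_mem (valP T)))).

Definition suspension : topologicalType :=
  (sigma_space * set_type `[0 : R, 1])%type.

Definition glue (x y : suspension) : Prop :=
  [/\ \val x.2 = 1, \val y.2 = 0 & y.1 = sigma_shift x.1].

Definition glue_rel (x y : suspension) : bool :=
  `[< clos_refl_sym_trans _ glue x y >].

Lemma glue_rel_equiv : equiv_class_of glue_rel.
Proof.
split.
- by move=> x; apply/asboolP; exact: rst_refl.
- by move=> x y; apply/idP/idP => /asboolP h; apply/asboolP; exact: rst_sym.
- move=> y x z /asboolP h /asboolP h'; apply/asboolP; exact: rst_trans h h'.
Qed.

Canonical glue_equiv := EquivRelPack glue_rel_equiv.

Definition tiling_space : topologicalType :=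
  quotient_topology {eq_quot glue_rel}.

End TilingSpace.

(* Z_p as the inverse limit of the rings Z/p^n, whose elements are represented
   by their least residues *)
Record padic_int (p : nat) := PadicInt {
  padic_res :> nat -> nat ;
  padic_res_lt : forall n, (padic_res n < p ^ n)%N ;
  padic_res_compat : forall n, (padic_res n.+1 = padic_res n %[mod p ^ n])%N }.

(* alpha = \sum_(k >= 0) eps_k p^k: the n-th partial sum lies in [0, p^n) and
   is therefore the least residue of alpha modulo p^n. *)
Definition padic_expansion (p : nat) (alpha : padic_int p)
    (eps : nat -> 'I_p) : Prop :=
  forall n, alpha n = (\sum_(k < n) eps k * p ^ k)%N.

Definition degenerate (eps : nat -> 'I_3) : Prop :=
  exists N, (forall n, (N <= n)%N -> eps n = 0%N :> nat) \/
            (forall n, (N <= n)%N -> eps n = 2%N :> nat).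

Definition letter := bool.
Definition la : letter := false.
Definition lb : letter := true.

Definition psi (i : 'I_3) : subst letter := fun c =>
  match (i : nat), c with
  | 0, false => [:: la; la; lb; lb; la]
  | 0, true => [:: lb]
  | 1, false => [:: la; la; lb]
  | 1, true => [:: lb; lb; la]
  | _, false => [:: la]
  | _, true => [:: lb; lb; la; la; lb]
  end.

Definition matB (i : 'I_3) : 'M[int]_2 :=
  \matrix_(r, c) nth 0 (nth [::] [:: [:: 1; (i : nat)%:Z]; [:: 0; 3]] r) c.

(* Z^2 consists of column vectors, on which the matrices act from the left. *)
Definition G_alpha (eps : nat -> 'I_3) : zmodType :=
  @seqlim 'cV[int]_2 (fun n => mulmx (matB (eps n))).

(* Main.v *)
(** Let X be the subshift.  H^1 of the tiling space, which is the suspension of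
    X, classifies Z-torsors; such a torsor is trivial on X * [0, 1], hence is
    given by a gluing function X -> Z, and H^1 is the group of locally constant
    functions X -> Z modulo the coboundaries k - k o shift.

    The three substitutions can be desubstituted by local rules, even on the
    full shift, so every point of X is tiled at each level n by the words
    psi_[0,n)(a) and psi_[0,n)(b) in a locally determined way.  For n large a
    given function is cohomologous to a combination of the indicators of pairs
    cr of consecutive level-n tiles.  Modulo coboundaries these are spanned by
    the indicators of the tiles a and b, which generate Z^2 and are related by
    the matrices B_i as n grows, and by the indicator of the pair ab, which can
    be traded, up to sign, for the indicator of the word ab in X: this is the
    extra summand Z.  There are no other relations because all four pairs of
    tiles occur at every level, which together with the growth of both tiles
    is where non-degeneracy enters. *)

From HB Require Import structures.
Require Import Defs.
From mathcomp Require Import all_boot all_order all_algebra.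
From mathcomp Require Import all_classical all_reals all_analysis.
From mathcomp Require Import zify ring lra.

Set Implicit Arguments.
Unset Strict Implicit.
Unset Printing Implicit Defensive.

Import Order.TTheory GRing.Theory Num.Theory.
Import numFieldNormedType.Exports.

Local Open Scope classical_set_scope.
Local Open Scope ring_scope.

(** * Tilings of the integers and desubstitution *)

(** A point of the subshift is known only through finite windows, and no preimage under the
    substitutions comes with it. The desubstitution rules are therefore verified on inflations of
    arbitrary tilings of the integers, and each window of a point is embedded in such an inflation.
    The pair [ab] of level [n] can be traded for the word [ab] over the integers because the
    coefficient is 1 or -1: the words of the two tiles of a level end in distinct letters, so
    exactly one of them creates [ab] in front of a [b] tile. Independence rests on one observation:
    at the start of a long tile, a function [k] with [f = k - k o shift] depends only on the label
    of that tile. Summing over a tile [c] followed by [r] gives [K c - K r], and the alternating sum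
    over the four pairs isolates the coefficient of the extra summand. Both identifications are
    relations rather than maps, so nothing has to be shown well defined on a limit of quotients. *)

Definition wlen (len : letter -> nat) (u : seq letter) : nat :=
  sumn (map len u).

Lemma wlen_cat len u v : wlen len (u ++ v) = (wlen len u + wlen len v)%N.
Proof. by rewrite /wlen map_cat sumn_cat. Qed.

Lemma wlen_cons len c v : wlen len (c :: v) = (len c + wlen len v)%N.
Proof. by []. Qed.

Lemma wlen_subst len (sub : subst letter) u :
  wlen len (subst_word sub u) = wlen (fun c => wlen len (sub c)) u.
Proof. by elim: u => //= c u IH; rewrite wlen_cat wlen_cons IH. Qed.

Lemma wlen_split len u i : (i < wlen len u)%N ->
  exists p c q, [/\ u = p ++ c :: q, (wlen len p <= i)%N &
                    (i < wlen len p + len c)%N].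
Proof.
elim: u i => //= c u IH i; rewrite wlen_cons => hi.
case: (ltnP i (len c)) => h; first by exists [::], c, u.
have [|p [d [q [-> h1 h2]]]] := IH (i - len c)%N; first by lia.
by exists (c :: p), d, q; split => //; rewrite wlen_cons; lia.
Qed.

Lemma wlen_split_inj len p c q p' c' q' :
  p ++ c :: q = p' ++ c' :: q' -> (wlen len p <= wlen len p')%N ->
  (wlen len p' < wlen len p + len c)%N -> 
  (forall d, 0 < len d)%N -> p = p' /\ c = c'.
Proof.
move=> e h1 h2 pos; elim: p p' e h1 h2 => [|d p IH] [|d' p'] //=.
- by case=> ->.
- by case=> -> _ _; rewrite wlen_cons /wlen /= => h; exfalso; lia.
- move=> _; rewrite wlen_cons /wlen /= => h _; exfalso.
  by have := pos d; lia.
- case=> <- e; rewrite !wlen_cons => h1 h2.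
  by have [||-> ->] := IH p' e; [lia|lia|].
Qed.

(* A marking records at which integer positions a tile of which label starts. *)
Definition marking := int -> letter -> Prop.

Fixpoint reads (len : letter -> nat) (O : marking) (j : int) (u : seq letter) :=
  if u is c :: v then O j c /\ reads len O (j + (len c)%:Z) v else True.

Lemma reads_cat len O j u v : reads len O j (u ++ v) <->
  reads len O j u /\ reads len O (j + (wlen len u)%:Z) v.
Proof.
elim: u j => [|c u IH] j /=; first by rewrite addr0; tauto.
rewrite IH wlen_cons.
have -> : j + (len c + wlen len u)%N%:Z = j + (len c)%:Z + (wlen len u)%:Z by lia.
tauto.
Qed.

Record tiling (len : letter -> nat) (O : marking) : Prop := Tiling {
  tiling_cover : forall j, exists c (i : nat), (i < len c)%N /\ O (j - i%:Z) c ;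
  tiling_uniq : forall x y c d, O x c -> O y d -> x <= y ->
    y < x + (len c)%:Z -> x = y /\ c = d }.

Lemma tiling_next len O x c : tiling len O -> O x c ->
  exists d, O (x + (len c)%:Z) d.
Proof.
move=> [cov uni] hx; have [d [i [id hy]]] := cov (x + (len c)%:Z).
case: i id hy => [|i] id hy; first by exists d; rewrite subr0 in hy.
case: (lerP x (x + (len c)%:Z - i.+1%:Z)) => h.
  by have [e1 e2] := uni _ _ _ _ hx hy h ltac:(lia); subst d; lia.
by have [] := uni _ _ _ _ hy hx ltac:(lia) ltac:(lia); lia.
Qed.

Lemma tiling_prev len O x c : tiling len O -> O x c ->
  exists d, O (x - (len d)%:Z) d.
Proof.
move=> [cov uni] hx; have [d [i [id hy]]] := cov (x - 1).
exists d; suff -> : x - (len d)%:Z = x - 1 - i%:Z by [].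
case: (ltrP x (x - 1 - i%:Z + (len d)%:Z)) => h; last by lia.
by have [] := uni _ _ _ _ hy hx ltac:(lia) ltac:(lia); lia.
Qed.

Lemma tiling_reads_compat len O j u v : tiling len O ->
  (forall c, 0 < len c)%N -> reads len O j u -> reads len O j v ->
  prefix u v || prefix v u.
Proof.
move=> [_ uni] pos; elim: u j v => [|c u IH] j [|d v] //=.
move=> [h1 h2] [h3 h4].
have pc := pos c.
have [_ e] := uni _ _ _ _ h1 h3 (lexx _) ltac:(lia); subst d.
by rewrite eqxx /=; exact: IH h2 h4.
Qed.

Section Desubstitution.
Context (sub : subst letter) (len : letter -> nat).

Definition blow (O : marking) : marking := fun j c =>
  exists c' p q, sub c' = p ++ c :: q /\ O (j - (wlen len p)%:Z) c'.

(* The second condition only matters for a letter whose image is a single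
   letter: it excludes the occurrences of that letter inside the long image. *)
Definition collapse (O : marking) : marking := fun j c =>
  reads len O j (sub c) /\
  forall c' p q, sub c' = p ++ q -> p <> [::] -> q <> [::] ->
    ~ reads len O (j - (wlen len p)%:Z) (sub c').

(** A finite test: an image of several letters placed at a wrong offset is contradicted within the
    rest of the current image and the next one. Comparing also when [q ++ sub r] is the shorter word
    makes one tile of look-ahead enough. By the last clause a one-letter image is the letter
    itself. *)
Definition recognizable : Prop :=
  (forall c c' r p q, (1 < size (sub c))%N -> sub c' = p ++ q -> q <> [::] ->
    prefix (sub c) (q ++ sub r) || prefix (q ++ sub r) (sub c) ->
    p = [::] /\ c' = c) /\
  (forall c, exists u, sub c = c :: u).

Local Notation blen := (fun c => wlen len (sub c)).

Lemma reads_blow O j v : reads blen O j v ->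
  reads len (blow O) j (subst_word sub v).
Proof.
elim: v j => //= c v IH j [hO hv]; apply/reads_cat; split; last exact: IH.
suff H : forall p q, sub c = p ++ q -> reads len (blow O) (j + (wlen len p)%:Z) q.
  by have := H [::] (sub c) erefl; rewrite addr0.
move=> p q; elim: q p => //= d q IHq p e; split.
  by exists c, p, q; split => //; rewrite addrK.
have := IHq (rcons p d); rewrite cat_rcons => /(_ e).
by rewrite -cats1 wlen_cat /wlen /= addn0 PoszD addrA.
Qed.

Context (pos : forall c, (0 < len c)%N).

Lemma tiling_blow O : tiling blen O -> tiling len (blow O).
Proof.
move=> [cov uni]; split.
  move=> j; have [c [i [ic hO]]] := cov j.
  have [p [d [q [e h1 h2]]]] := wlen_split ic.
  exists d, (i - wlen len p)%N; split; first by lia.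
  exists c, p, q; split => //.
  by have -> : j - (i - wlen len p)%N%:Z - (wlen len p)%:Z = j - i%:Z by lia.
move=> x y c d [c' [p [q [e hO]]]] [d' [p' [q' [e' hO']]]] xy yx.
have l1 : blen c' = (wlen len p + (len c + wlen len q))%N.
  by rewrite e wlen_cat wlen_cons.
have l2 : blen d' = (wlen len p' + (len d + wlen len q'))%N.
  by rewrite e' wlen_cat wlen_cons.
have pd := pos d.
have [E1 E2] : x - (wlen len p)%:Z = y - (wlen len p')%:Z /\ c' = d'.
  case: (lerP (x - (wlen len p)%:Z) (y - (wlen len p')%:Z)) => h.
    by apply: uni hO hO' h _; rewrite l1; lia.
  by have [-> ->] := uni _ _ _ _ hO' hO ltac:(lia) ltac:(rewrite l2; lia).
subst d'; rewrite e in e'.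
have [ep ->] := wlen_split_inj (len := len) e' ltac:(lia) ltac:(lia) pos.
by subst p'; split => //; lia.
Qed.

(** The first letter of the occurrence lies in some tile [c']. The rest of its image and the image
    of the next tile are read from the same position, and two words read from one position are
    comparable, which is the premise of [recognizable]. *)
Lemma reads_blow_recognized O j c : recognizable -> tiling blen O ->
  (1 < size (sub c))%N -> reads len (blow O) j (sub c) -> O j c.
Proof.
move=> [rec hd] til sc hr; have [u eu] := hd c.
move: (hr); rewrite {1}eu /= => -[[c' [p [q [e hO]]]] _].
have [r hr'] := tiling_next til hO.
have : reads blen O (j - (wlen len p)%:Z) [:: c'; r] by [].
move/reads_blow; rewrite /subst_word /= cats0 e -catA => /reads_cat[_].
rewrite subrK => hq.
have /rec := tiling_reads_compat (tiling_blow til) pos hr hq.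
by move=> /(_ c' p sc e) [//|? ?]; subst p c'; rewrite /wlen /= subr0 in hO.
Qed.

Lemma collapse_blow O j c : recognizable -> tiling blen O ->
  collapse (blow O) j c <-> O j c.
Proof.
move=> rec til; have [rec1 hd] := rec; split.
  move=> [hr hn].
  case: (ltnP 1 (size (sub c))) => sc; first exact: reads_blow_recognized hr.
  (* Here [c] is its own image: either it opens a tile, which is then labelled [c], or it lies
     further inside an image, which [collapse] forbids. *)
  have [u eu] := hd c; rewrite eu in sc hr; case: u eu sc hr => // eu _ /=.
  move=> [[c' [p [q [e hO]]]] _].
  case: p e hO => [|d p] e hO.
    have [v ev] := hd c'; rewrite ev in e; case: e hO => -> _.
    by rewrite /wlen /= subr0.
  case: (hn c' (d :: p) (c :: q) e) => //.
  have : reads blen O (j - (wlen len (d :: p))%:Z) [:: c'] by [].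
  by move/reads_blow; rewrite /subst_word /= cats0.
(* Conversely, an image starting before [j] and ending after it would come from a genuine tile
   overlapping the tile at [j]. *)
move=> hO; split.
  have : reads blen O j [:: c] by [].
  by move/reads_blow; rewrite /subst_word /= cats0.
move=> c' p q e p0 q0 hr.
have pos' x : x <> [::] -> (0 < wlen len x)%N.
  by case: x => // d x _; rewrite wlen_cons; have := pos d; lia.
have sc : (1 < size (sub c'))%N.
  by rewrite e size_cat; case: (p) p0 => //; case: (q) q0 => // *; rewrite /= ; lia.
have hO' := reads_blow_recognized rec til sc hr.
have h1 := pos' _ p0; have h2 := pos' _ q0.
by have [] := tiling_uniq til hO' hO ltac:(lia) ltac:(rewrite /= e wlen_cat; lia); lia.
Qed.

End Desubstitution.

Lemma psi_recognizable i : recognizable (psi i).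
Proof.
split; last first.
  by case: i => -[|[|[|//]]] ? []; rewrite /psi /=; eexists; reflexivity.
move=> c c' r p q.
by case: i => -[|[|[|//]]] ? /=; case: c; case: c'; case: r => //= _;
  move: p => [|?[|?[|?[|?[|?[|? p]]]]]] //= e q0 h; case: e;
  intros; subst; simpl in *; try discriminate.
Qed.

Lemma psi_cons i c : exists u, psi i c = c :: u.
Proof. exact: (psi_recognizable i).2. Qed.

Lemma tiling_exists len v : (forall c, 0 < len c)%N ->
  exists O, tiling len O /\ reads len O 0 v.
Proof.
move=> pos; pose x k := nth la v k; pose ps k := (\sum_(i < k) len (x i))%N.
have psS k : ps k.+1 = (ps k + len (x k))%N by rewrite /ps big_ord_recr.
have psm k l : (k < l)%N -> (ps k + len (x k) <= ps l)%N.
  by elim: l => // l IH; rewrite ltnS leq_eqVlt => /orP[/eqP->|/IH]; rewrite psS; lia.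
pose O : marking := fun j c => (exists k, j = (ps k)%:Z /\ c = x k) \/
  (exists k : nat, j = - (k.+1 * len la)%N%:Z /\ c = la).
exists O; split; last first.
  suff H : forall u w, v = u ++ w -> reads len O (ps (size u))%:Z w.
    by have := H [::] v erefl; rewrite /ps big_ord0.
  move=> u w; elim: w u => //= c w IH u e.
  have ec : c = x (size u) by rewrite /x e nth_cat ltnn subnn.
  split; first by left; exists (size u).
  have := IH (rcons u c); rewrite cat_rcons size_rcons psS -ec => /(_ e).
  by rewrite PoszD.
split.
  move=> [j|j].
    suff [k [i [h1 ->]]] : exists k i, (i < len (x k))%N /\ j = (ps k + i)%N.
      by exists (x k), i; split => //; left; exists k; split => //; lia.
    elim: j => [|j [k [i [h1 ->]]]].
      by exists 0%N, 0%N; split; [exact: pos|rewrite /ps big_ord0].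
    case: (ltnP i.+1 (len (x k))) => h; first by exists k, i.+1; rewrite addnS.
    by exists k.+1, 0%N; rewrite psS; split; [exact: pos|lia].
  have := divn_eq j (len la); have := ltn_pmod j (pos la).
  set q := (_ %/ _)%N; set r := (_ %% _)%N => rl e.
  exists la, (len la - r.+1)%N; split; first by have := pos la; lia.
  by right; exists q; split => //; rewrite NegzE mulSn; lia.
move=> y z c d [[k [-> ->]]|[k [-> ->]]] [[l [-> ->]]|[l [-> ->]]] h1 h2.
- case: (ltngtP k l) => [kl|kl|->] //.
    by have := psm _ _ kl; lia.
  by have := psm _ _ kl; have := pos (x l); lia.
- by have := pos la; rewrite mulSn in h1; lia.
- by rewrite mulSn in h2; lia.
- suff -> : k = l by [].
  have p := pos la; rewrite !mulSn in h1 h2.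
  have kl : (l * len la <= k * len la)%N by lia.
  have kl' : (k * len la < l.+1 * len la)%N by rewrite mulSn; lia.
  by rewrite leq_pmul2r // in kl; rewrite ltn_pmul2r // in kl'; lia.
Qed.

Section Levels.
Context (s : nat -> 'I_3).

(* occ n T marks the level-n tiles of T, found by desubstituting with
   psi (s 0), ..., psi (s (n-1)) through local rules; blown n inflates back. *)
Fixpoint llen (n : nat) (c : letter) : nat :=
  if n is m.+1 then wlen (llen m) (psi (s m) c) else 1.

Fixpoint occ (n : nat) (T : int -> letter) : marking :=
  if n is m.+1 then collapse (psi (s m)) (llen m) (occ m T)
  else fun j c => T j = c.

Fixpoint blown (n : nat) (O : marking) : marking :=
  if n is m.+1 then blown m (blow (psi (s m)) (llen m) O) else O.

(** [subst_range] at [m] composes [m.+1] substitutions; the shifted index makes level 0 the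
    identity. *)
Definition lword (n : nat) : subst letter :=
  if n is m.+1 then subst_range psi s m else fun c => [:: c].

Lemma lwordS n c : lword n.+1 c = subst_word (lword n) (psi (s n) c).
Proof. by case: n => [|n] //=; rewrite /subst_word flatten_seq1. Qed.

Lemma subst_word_cat (f : subst letter) u v :
  subst_word f (u ++ v) = subst_word f u ++ subst_word f v.
Proof. by rewrite /subst_word map_cat flatten_cat. Qed.

Lemma subst_word_comp (f g : subst letter) u :
  subst_word f (subst_word g u) = subst_word (fun c => subst_word f (g c)) u.
Proof. by elim: u => //= c u IH; rewrite subst_word_cat IH. Qed.

Lemma size_lword n c : size (lword n c) = llen n c.
Proof.
elim: n c => [|n IH] c //; rewrite lwordS /=.
by elim: (psi _ _) => //= d u IHu; rewrite size_cat IHu wlen_cons IH.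
Qed.

Lemma size_subst_lword n u : size (subst_word (lword n) u) = wlen (llen n) u.
Proof. by elim: u => //= c u IH; rewrite size_cat size_lword IH. Qed.

Lemma llen_gt0 n c : (0 < llen n c)%N.
Proof.
elim: n c => [|n IH] c //=; have [u ->] := psi_cons (s n) c.
by rewrite wlen_cons; have := IH c; lia.
Qed.

Lemma blown_tiling n O : tiling (llen n) O -> tiling (llen 0) (blown n O).
Proof.
by elim: n O => //= n IH O h; apply: IH; apply: tiling_blow h; exact: llen_gt0.
Qed.

Lemma blown_word n O : tiling (llen n) O -> exists T, blown n O = occ 0 T.
Proof.
move=> /blown_tiling[cov uni].
have ex j : exists c, blown n O j c.
  by have [c [[|i] []]] := cov j; rewrite // subr0; exists c.
have [T hT] := choice ex; exists T; apply/funext => j; apply/funext => c.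
apply/propext; split => [h|<-//].
by have [] := uni _ _ _ _ (hT j) h (lexx _) ltac:(rewrite /=; lia).
Qed.

Lemma occ_blown n O T : tiling (llen n) O -> blown n O = occ 0 T ->
  occ n T = O.
Proof.
elim: n O => [|n IH] O til e; first by rewrite -e.
rewrite /= (IH (blow (psi (s n)) (llen n) O)) //.
  apply/funext => j; apply/funext => c; apply/propext.
  by apply: collapse_blow; [exact: llen_gt0|exact: psi_recognizable|].
by apply: tiling_blow til; exact: llen_gt0.
Qed.

Lemma reads_blown n O j v : reads (llen n) O j v ->
  reads (llen 0) (blown n O) j (subst_word (lword n) v).
Proof.
elim: n O v => [|n IH] O v; first by rewrite /subst_word flatten_seq1.
move=> /reads_blow /IH; rewrite subst_word_comp.
by congr (reads _ _ _ _); rewrite /subst_word; congr flatten; apply: eq_map => c;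
  exact/esym/lwordS.
Qed.

Lemma reads_collapsed sub len O j v :
  reads (fun c => wlen len (sub c)) (collapse sub len O) j v ->
  reads len O j (subst_word sub v).
Proof.
by elim: v j => //= c v IH j [[h _] h']; apply/reads_cat; split; last exact: IH.
Qed.

Lemma reads_occ n T j v : reads (llen n) (occ n T) j v ->
  reads (llen 0) (occ 0 T) j (subst_word (lword n) v).
Proof.
elim: n v => [|n IH] v; first by rewrite /subst_word flatten_seq1.
move=> /reads_collapsed /IH; rewrite subst_word_comp.
by congr (reads _ _ _ _); rewrite /subst_word; congr flatten; apply: eq_map => c;
  exact/esym/lwordS.
Qed.

Lemma reads_letterP T j v : reads (llen 0) (occ 0 T) j v <->
  v = mkseq (fun k => T (j + k%:Z)) (size v).
Proof.
elim: v j => //= c v IH j.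
have -> : mkseq (fun k => T (j + k%:Z)) (size v).+1 =
    T j :: mkseq (fun k => T (j + 1 + k%:Z)) (size v).
  rewrite /mkseq /= addr0; congr (_ :: _).
  rewrite (iotaDl 1 0) -map_comp; apply: eq_map => k /=.
  by rewrite PoszD addrA.
split; first by move=> [-> /IH <-].
by case=> -> e; split => //; apply/IH.
Qed.

Lemma occ_letters n T j c i : occ n T j c -> (i < llen n c)%N ->
  T (j + i%:Z) = nth la (lword n c) i.
Proof.
move=> h hi; have : reads (llen n) (occ n T) j [:: c] by [].
move=> /reads_occ /reads_letterP; rewrite /subst_word /= cats0 => ->.
by rewrite nth_mkseq // size_lword.
Qed.

Definition agree (A : Type) (r : nat) (j : int) (T T' : int -> A) : Prop :=
  forall i, j - r%:Z <= i <= j + r%:Z -> T i = T' i.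

Lemma agree_sub (A : Type) r j r' j' (T T' : int -> A) : agree r j T T' -> j - r%:Z <= j' - r'%:Z ->
  j' + r'%:Z <= j + r%:Z -> agree r' j' T T'.
Proof. by move=> h h1 h2 i hi; apply: h; lia. Qed.

Lemma reads_ext len O O' j v :
  (forall i c, j <= i < j + (wlen len v)%:Z -> O i c <-> O' i c) ->
  (forall c, 0 < len c)%N ->
  reads len O j v <-> reads len O' j v.
Proof.
move=> h pos; elim: v j h => //= c v IH j; rewrite wlen_cons => h.
have pc := pos c.
rewrite IH; last by move=> i d hi; apply: h; lia.
by rewrite h //; lia.
Qed.

Lemma occ_local n : exists r, forall T T' j, agree r j T T' ->
  forall c, occ n T j c <-> occ n T' j c.
Proof.
elim: n => [|n [r hr]]; first by exists 0%N => T T' j h c; rewrite /= h //; lia.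
(* The rule for level [n.+1] goes back by at most one image and then reads one image; [m] bounds
   both lengths. *)
pose m := (llen n.+1 la + llen n.+1 lb)%N.
have lm c : (llen n.+1 c <= m)%N by rewrite /m; case: c; [exact: leq_addl|exact: leq_addr].
have rd T T' j c k : agree (r + m + m) j T T' -> (k <= m)%N ->
    reads (llen n) (occ n T) (j - k%:Z) (psi (s n) c) <->
    reads (llen n) (occ n T') (j - k%:Z) (psi (s n) c).
  move=> ag km; have lc : (wlen (llen n) (psi (s n) c) <= m)%N := lm c.
  apply: reads_ext; last exact: llen_gt0.
  by move=> i d hi; apply: hr; apply: agree_sub ag _ _; lia.
have km c p q : psi (s n) c = p ++ q -> (wlen (llen n) p <= m)%N.
  move=> e; have := lm c; rewrite /= e wlen_cat; lia.
suff H T T' j c : agree (r + m + m) j T T' -> occ n.+1 T j c -> occ n.+1 T' j c.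
  exists (r + m + m)%N => T T' j ag c; split; first exact: H ag.
  by apply: (H T' T) => i hi; rewrite ag.
move=> ag [h1 h2]; split.
  by have := rd T T' j c 0%N ag isT; rewrite subr0 => -[+ _]; exact.
move=> c' p q e p0 q0 h; apply: (h2 _ _ _ e p0 q0).
by apply/(rd T T' j c' _ ag); first exact: km e.
Qed.

Lemma occ_shift n T j c k :
  occ n (fun i => T (i + k)) j c <-> occ n T (j + k) c.
Proof.
suff -> : occ n (fun i => T (i + k)) = (fun j c => occ n T (j + k) c) by [].
elim: n {j c} => //= n IH; rewrite IH.
have rd len O j v : reads len (fun j c => O (j + k) c) j v <->
    reads len O (j + k) v.
  by elim: v j => //= c v IHv j; rewrite IHv addrAC.
apply/funext => j; apply/funext => c; apply/propext.
rewrite /collapse rd; split => -[h1 h2]; split => // c' p q e p0 q0.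
  by have := h2 _ _ _ e p0 q0; rewrite rd addrAC.
by rewrite rd addrAC; exact: h2 e p0 q0.
Qed.

Lemma prefix_lwordS n c : prefix (lword n c) (lword n.+1 c).
Proof.
rewrite lwordS; have [u ->] := psi_cons (s n) c.
exact: prefix_prefix.
Qed.

Lemma lword_level n m c : exists v, lword (n + m) c = subst_word (lword n) v.
Proof.
elim: m c => [|m IH] c; first by exists [:: c]; rewrite addn0 /subst_word /= cats0.
have [v hv] := choice IH.
exists (subst_word v (psi (s (n + m)) c)); rewrite addnS lwordS subst_word_comp.
by rewrite /subst_word; congr flatten; apply: eq_map.
Qed.

Local Notation adm := (admitted_space psi s : set (full_shift letter)).

(** The word witnessing admissibility may have level below [n]. Since each image starts with its own
    letter, that word is a prefix of one of level above [n], which splits into words of level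
    [n]. *)
Lemma admitted_level (T : full_shift letter) n i l : adm T ->
  exists v, infix (subword T i l) (subst_word (lword n) v).
Proof.
move=> /(_ i l)[m [c h]].
have [v e] := lword_level n m.+1 c; exists v; rewrite -e; apply: infix_trans h _.
rewrite addnC {e}; elim: n => [|n IH]; first by rewrite addn0 infix_refl.
by rewrite addnS; apply: infix_trans IH _; exact/prefixW/prefix_lwordS.
Qed.

(* Locally, a point of the subshift looks like an inflated tiling of Z, for
   which occ is known by recognizability. *)
Lemma occ_tiling_local (T : full_shift letter) n (j : int) r : adm T ->
  exists O d, tiling (llen n) O /\
    forall i c, j - r%:Z <= i <= j + r%:Z -> occ n T i c <-> O (i - d) c.
Proof.
move=> hT; have [r' hr'] := occ_local n.
pose m := (r + r')%N.
have [v /infixP[p [q e]]] := admitted_level n (j - m%:Z) (m + m).+1 hT.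
have [ O [til hO]] := tiling_exists v (llen_gt0 n).
have [T' eT'] := blown_word til.
have := reads_blown hO; rewrite eT' e => /reads_cat[_ /reads_cat[+ _]].
move=> /reads_letterP; rewrite size_mkseq => eT.
have occO := occ_blown til eT'.
have wp : wlen (llen 0) p = size p by elim: (p) => //= a u IHu; rewrite wlen_cons IHu.
pose d := j - m%:Z - (size p)%:Z; exists O, d; split => // i c hi.
rewrite -occO -[X in _ <-> X]occ_shift; apply: hr' => x hx.
pose k := absz (x - (j - m%:Z))%R.
have kx : x = j - m%:Z + k%:Z by rewrite /k; lia.
have km : (k < (m + m).+1)%N by rewrite /k /m; lia.
move/(congr1 (fun u => nth la u k)): eT; rewrite !nth_mkseq // -kx => ->.
by rewrite wp; congr T'; rewrite kx /d; lia.
Qed.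

(** Each clause of [tiling] concerns a bounded window, so it is inherited from an inflated tiling
    that agrees there. *)
Lemma occ_tiling (T : full_shift letter) n : adm T -> tiling (llen n) (occ n T).
Proof.
move=> hT; split.
  move=> j; pose m := (llen n la + llen n lb)%N.
  have lm c : (llen n c <= m)%N by rewrite /m; case: c; [exact: leq_addl|exact: leq_addr].
  have [ O [d [til h]]] := occ_tiling_local n j m hT.
  have [c [i [ic hO]]] := tiling_cover til (j - d); exists c, i; split => //.
  apply/h; first by have := lm c; lia.
  by rewrite addrAC.
move=> x y c d hx hy xy yx; pose m := absz (y - x)%R.
have [ O [e [til h]]] := occ_tiling_local n x m hT.
move: hx hy; rewrite !h; try by rewrite /m; lia.
move=> hx hy.
have [E ->] := tiling_uniq til hx hy ltac:(lia) ltac:(lia).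
by split => //; lia.
Qed.

End Levels.

(** * Growth of tiles, occurrence of pairs, and existence of points *)

Section Nondegenerate.
Context (s : nat -> 'I_3) (hnd : ~ degenerate s).

Local Notation adm := (admitted_space psi s : set (full_shift letter)).

(* The index of the substitution that fixes the letter c. *)
Definition inert (c : letter) : nat := if c then 0%N else 2.

Lemma often_not_inert (c : letter) N :
  exists2 n, (N <= n)%N & s n <> inert c :> nat.
Proof.
apply: contrapT => h; apply: hnd; exists N.
have e n : (N <= n)%N -> s n = inert c :> nat.
  by move=> Nn; apply: contrapT => e; apply: h; exists n.
by case: c e {h} => e; [left|right].
Qed.

Lemma llen_leS n c : (llen s n c <= llen s n.+1 c)%N.
Proof. by rewrite -!size_lword; apply/size_prefix/prefix_lwordS. Qed.

Lemma llen_ltS n c : s n <> inert c :> nat -> (llen s n c < llen s n.+1 c)%N.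
Proof.
have := llen_gt0 s n la; have := llen_gt0 s n lb; rewrite /inert /= /la /lb.
by case: (s n) c => -[|[|[|//]]] ? [] //= h1 h2 h; rewrite /wlen /= /la /lb; lia.
Qed.

Lemma llen_mono n m c : (n <= m)%N -> (llen s n c <= llen s m c)%N.
Proof.
elim: m => [|m IH]; first by rewrite leqn0 => /eqP ->.
rewrite leq_eqVlt => /orP[/eqP <- //|/IH h].
exact: leq_trans h (llen_leS m c).
Qed.

Lemma llen_large L : exists N, forall n c, (N <= n)%N -> (L <= llen s n c)%N.
Proof.
have H c : exists N, (L <= llen s N c)%N.
  elim: L => [|L [N hN]]; first by exists 0%N.
  have [n Nn hn] := often_not_inert c N; exists n.+1.
  exact: leq_ltn_trans (leq_trans hN (llen_mono c Nn)) (llen_ltS hn).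
have [N1 h1] := H la; have [N2 h2] := H lb; exists (maxn N1 N2) => n c.
rewrite geq_max => /andP[l1 l2]; case: c.
  exact: leq_trans h2 (llen_mono _ l2).
exact: leq_trans h1 (llen_mono _ l1).
Qed.

Lemma reads_occS n T j c : occ s n.+1 T j c ->
  reads (llen s n) (occ s n T) j (psi (s n) c).
Proof. by move=> []. Qed.

Lemma occ_mem n T j c d : occ s n.+1 T j c -> d \in psi (s n) c ->
  exists i, occ s n T i d.
Proof.
move=> /reads_occS h hd; move: h; case/path.splitPr: hd => p q.
move=> /reads_cat[_ /= [h _]].
by eexists; exact: h.
Qed.

(** If [c] is missing at level [m], it is missing at level [m.+1] too, because the image of [c]
    starts with [c]. Then all tiles of level [m.+1] carry the other letter, whose image avoids [c],
    so [psi (s m)] fixes that letter. This repeats for all larger [m] and makes [s] degenerate. *)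
Lemma occ_letter (T : full_shift letter) n c : adm T -> exists j, occ s n T j c.
Proof.
move=> hT; apply: contrapT => h.
have mem m : ~ (exists j, occ s m T j c) ->
    ~ (exists j, occ s m.+1 T j c) /\ s m = inert (~~ c) :> nat.
  move=> hm; have no j d : occ s m.+1 T j d -> c \notin psi (s m) d.
    by move=> hd; apply/negP => hc; apply: hm; exact: occ_mem hd hc.
  have n1 : ~ (exists j, occ s m.+1 T j c).
    by move=> [j /no]; have [u ->] := psi_cons (s m) c; rewrite mem_head.
  split => //; have [d [i [_ hd]]] := tiling_cover (occ_tiling m.+1 hT) 0.
  have := no _ _ hd; have {hd} : d <> c by move=> e; apply: n1; exists (0 - i%:Z); rewrite -e.
  by case: (s m) c d {h hm no n1} => -[|[|[|//]]] ? [] [].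
have all m : (n <= m)%N -> ~ (exists j, occ s m T j c).
  elim: m => [|m IH]; first by rewrite leqn0 => /eqP <-.
  by rewrite leq_eqVlt => /orP[/eqP <- //|/IH /mem[]].
by have [m nm] := often_not_inert (~~ c) n; apply; have [] := mem _ (all _ nm).
Qed.

(** Both [aabba] and [bbaab] contain all four two-letter words; for the middle substitution, [aab]
    contains those starting with [a] and [bba] those starting with [b]. *)
Lemma psi_infix2 i c r : exists d, infix [:: c; r] (psi i d).
Proof.
case: i => -[|[|[|//]]] ?; [exists la|exists c|exists lb]; by case: c; case: r.
Qed.

Lemma occ_pair (T : full_shift letter) n c r : adm T ->
  exists j, occ s n T j c /\ occ s n T (j + (llen s n c)%:Z) r.
Proof.
move=> hT; have [d /infixP[p [q e]]] := psi_infix2 (s n) c r.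
have [j /reads_occS] := occ_letter n.+1 d hT.
rewrite e => /reads_cat[_ /= [h1 [h2 _]]].
by exists (j + (wlen (llen s n) p)%:Z).
Qed.

Lemma infix_mkseq (u : seq letter) k l : (k + l <= size u)%N ->
  infix (mkseq (fun i => nth la u (k + i)) l) u.
Proof.
move=> h; have -> : mkseq (fun i => nth la u (k + i)) l = take l (drop k u).
  apply: (@eq_from_nth _ la); rewrite size_mkseq.
    by rewrite size_take size_drop; case: ltnP => ?; lia.
  by move=> i il; rewrite nth_mkseq // nth_take // nth_drop.
by apply/infixP; exists (take k u), (drop l (drop k u)); rewrite !cat_take_drop.
Qed.

(* Words around the origin that extend one another on both sides. *)
Fixpoint left_letter (n : nat) : letter :=
  if n is m.+1 then (s m == 1%N :> nat) (+) left_letter m else la.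

Definition central (n : nat) : seq letter :=
  subst_word (lword s n) [:: left_letter n; la].

Lemma centralE n : central n = lword s n (left_letter n) ++ lword s n la.
Proof. by rewrite /central /subst_word /= cats0. Qed.

Lemma central_ext n : exists x y, [/\ central n.+1 = x ++ central n ++ y &
  llen s n.+1 (left_letter n.+1) = (size x + llen s n (left_letter n))%N].
Proof.
have [u eu] : exists u, psi (s n) (left_letter n.+1) = rcons u (left_letter n).
  rewrite /=; case: (s n) (left_letter n) => -[|[|[|//]]] ? [] /=.
  - by exists [::].
  - by exists [:: la; la; lb; lb].
  - by exists [:: la; la].
  - by exists [:: lb; lb].
  - by exists [:: lb; lb; la; la].
  - by exists [::].
have [v ev] := psi_cons (s n) la.
exists (subst_word (lword s n) u), (subst_word (lword s n) v); split.
  rewrite centralE !lwordS eu ev -cats1 subst_word_cat /central.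
  by rewrite /subst_word /= !cats0 -!catA.
by rewrite /= eu -cats1 wlen_cat /wlen /= addn0 -/(wlen _ _) size_subst_lword.
Qed.

(** The point is the union of the words [central n], aligned so that position 0 starts the
    right-hand tile. Both tiles outgrow every bound, so every position is eventually covered. *)
Lemma admitted_exists : exists T : full_shift letter, adm T.
Proof.
pose L n := (llen s n (left_letter n))%:Z.
pose valid n (j : int) := - L n <= j < (llen s n la)%:Z.
pose t n (j : int) := nth la (central n) (absz (j + L n)).
have szc n : size (central n) = (llen s n (left_letter n) + llen s n la)%N.
  by rewrite size_subst_lword /wlen /= addn0.
have step n j : valid n j -> valid n.+1 j /\ t n.+1 j = t n j.
  move=> /andP[h1 h2]; have [x [y [e e']]] := central_ext n.
  have := llen_leS n la => hla.
  have eL : L n.+1 = (size x)%:Z + L n by rewrite /L e' PoszD.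
  split; first by rewrite /valid eL; lia.
  rewrite /t e eL.
  have -> : absz (j + ((size x)%:Z + L n))%R = (size x + absz (j + L n)%R)%N by lia.
  rewrite nth_cat ltnNge leq_addr /= addKn nth_cat szc.
  by case: ltnP => // h; move: h1 h2 h; rewrite /L; lia.
have mono n m j : (n <= m)%N -> valid n j -> valid m j /\ t m j = t n j.
  elim: m => [|m IH]; first by rewrite leqn0 => /eqP ->.
  rewrite leq_eqVlt => /orP[/eqP <- //|/IH{}IH /IH[/step[v ->] ->]] //.
have ex j : exists n, valid n j.
  have [N hN] := llen_large (absz j).+1; exists N.
  by have := hN N (left_letter N) (leqnn N); have := hN N la (leqnn N);
    rewrite /valid /L; lia.
have [N hN] := choice ex; pose T j := t (N j) j; exists T => i l.
have TE n j : valid n j -> T j = t n j.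
  move=> v; have [_ e1] := mono _ _ _ (leq_maxl n (N j)) v.
  by have [_ e2] := mono _ _ _ (leq_maxr n (N j)) (hN j); rewrite /T -e2 e1.
have [n hn] := llen_large (absz i + l)%N.
have h1 := hn n (left_letter n) (leqnn n); have h2 := hn n la (leqnn n).
(* The two letters under [central n] are adjacent in some image, so [central n] occurs in a word of
   level [n.+1], which is [subst_range] at [n]. *)
have [d hd] := psi_infix2 (s n) (left_letter n) la; exists n, d.
apply: (@infix_trans _ (central n)).
  have -> : subword T i l =
      mkseq (fun k => nth la (central n) (absz (i + L n)%R + k)) l.
    rewrite /subword /mkseq; apply/eq_in_map => k; rewrite mem_iota => /andP[_ kl].
    rewrite (TE n) /t; first by congr nth; rewrite /L; lia.
    by rewrite /valid /L; lia.
  by apply: infix_mkseq; rewrite szc /L; lia.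
rewrite -[subst_range psi s n d]/(lword s n.+1 d) lwordS; case/infixP: hd => p [q ->].
by rewrite !subst_word_cat; exact: infix_infix.
Qed.

(* Distinct tiles of one level end in distinct letters, while each starts with
   its own label. *)
Lemma last_lword n c : last la (lword s n c) = c (+) left_letter n.
Proof.
elim: n c => [|n IH] c; first by rewrite /= addbF.
suff [u eu] : exists u, psi (s n) c = rcons u (c (+) (s n == 1%N :> nat)).
  rewrite lwordS eu -cats1 subst_word_cat last_cat /subst_word /= cats0.
  have := IH (c (+) (s n == 1%N :> nat)); rewrite -addbA => <-.
  by have := llen_gt0 s n (c (+) (s n == 1%N :> nat)); rewrite -size_lword; case: lword.
case: (s n) c => -[|[|[|//]]] ? [] /=.
- by exists [::].
- by exists [:: la; la; lb; lb].
- by exists [:: lb; lb].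
- by exists [:: la; la].
- by exists [:: lb; lb; la; la].
- by exists [::].
Qed.

End Nondegenerate.

(** * Locally constant functions on a subshift *)

Section ShiftTopology.
Context (A : choiceType).

(** The sets containing a cylinder around the origin form a filter, and its convergence in the
    product can be tested on each coordinate. *)
Lemma nbhs_full_shift (T : full_shift A) (B : set (full_shift A)) :
  nbhs T B <-> exists r, forall T', agree r 0 T T' -> B T'.
Proof.
split.
  pose G : set_system (full_shift A) :=
    [set C | exists r, forall T', agree r 0 T T' -> C T'].
  have GF : Filter G.
    split; first by exists 0%N.
      move=> C D [r hr] [r' hr']; exists (r + r')%N => T' h.
      by split; [apply: hr|apply: hr']; apply: agree_sub h _ _; lia.
    by move=> C D CD [r hr]; exists r => T' /hr /CD.
  suff : G --> T by move=> /[apply].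
  apply/cvg_sup => i; move=> C; rewrite nbhsE /= => -[D [[E oE <-] /= ET] DC].
  exists (absz i) => T' h; apply: DC => /=; rewrite -h //; lia.
move=> [r hr]; apply: filterS hr _.
have pr i : nbhs T [set T' : full_shift A | T i = T' i].
  have : nbhs T (proj i @^-1` [set T i]).
    by apply: (@proj_continuous int (fun=> discrete_topology A) i T);
      exact: (@discrete_set1 (discrete_topology A)).
  by apply: (@filterS _ (nbhs T)) => T' /= <-.
elim: r => [|r IH].
  by apply: filterS (pr 0) => T' /= h i hi; have -> : i = 0 by lia.
apply: filterS (filterI IH (filterI (pr r.+1%:Z) (pr (- r.+1%:Z)))).
move=> T' [h [/= h1 h2]] i hi.
have [->|i1] := eqVneq i r.+1%:Z => //.
have [->|i2] := eqVneq i (- r.+1%:Z) => //.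
by apply: h; lia.
Qed.

Context (I : Type) (F : I -> subst A) (s : nat -> I).

Local Notation X := (sigma_space F s).

Definition agreeX r (T T' : X) : Prop := agree r 0 (\val T) (\val T').

Lemma agreeX_sym r T T' : agreeX r T T' -> agreeX r T' T.
Proof. by move=> h i hi; rewrite h. Qed.

Lemma agreeX_trans r T T' T'' : agreeX r T T' -> agreeX r T' T'' -> agreeX r T T''.
Proof. by move=> h h' i hi; rewrite h // h'. Qed.

Lemma agreeX_le r r' T T' : (r' <= r)%N -> agreeX r T T' -> agreeX r' T T'.
Proof. by move=> rr h; apply: agree_sub h _ _; lia. Qed.

Lemma nbhs_sigma (T : X) (B : set X) :
  nbhs T B <-> exists r, forall T', agreeX r T T' -> B T'.
Proof.
split.
  move=> [C [[D oD <-] /= DT CB]].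
  have /nbhs_full_shift[r hr] : nbhs (set_val T : full_shift A) D.
    by apply: open_nbhs_nbhs; split.
  by exists r => T' h; apply: CB; apply: hr.
move=> [r hr].
have H : nbhs (set_val T : full_shift A)
    [set T' : full_shift A | agree r 0 (set_val T) T'].
  by apply/nbhs_full_shift; exists r.
have H' : nbhs T ((set_val : X -> full_shift A) @^-1`
    [set T' : full_shift A | agree r 0 (set_val T) T']).
  exact: (@initial_continuous _ _ (set_val : X -> full_shift A) T) H.
by apply: (@filterS _ (nbhs T) _ _ _ _ H') => T'; exact: hr.
Qed.

Lemma shift_agree r T T' : agreeX r.+1 T T' ->
  agreeX r (sigma_shift T) (sigma_shift T').
Proof. by move=> h i hi; rewrite /= /Defs.shift; apply: h; lia. Qed.

Definition loc_const (Y : Type) (f : X -> Y) : Prop :=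
  forall T, exists r, forall T', agreeX r T T' -> f T = f T'.

Lemma loc_const_comp (Y Z : Type) (f : X -> Y) (g : Y -> Z) :
  loc_const f -> loc_const (fun T => g (f T)).
Proof. by move=> h T; have [r hr] := h T; exists r => T' /hr ->. Qed.

Lemma loc_const_pair (Y Z : Type) (f : X -> Y) (g : X -> Z) :
  loc_const f -> loc_const g -> loc_const (fun T => (f T, g T)).
Proof.
move=> hf hg T; have [r hr] := hf T; have [r' hr'] := hg T.
exists (maxn r r') => T' h.
by rewrite (hr T') ?(hr' T') //; apply: agreeX_le h; rewrite ?leq_maxl ?leq_maxr.
Qed.

Lemma loc_const2 (Y Y' Z : Type) (op : Y -> Y' -> Z) f g :
  loc_const f -> loc_const g -> loc_const (fun T => op (f T) (g T)).
Proof.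
by move=> hf hg; apply: (loc_const_comp (fun p => op p.1 p.2) (loc_const_pair hf hg)).
Qed.

Lemma loc_const_shift (Y : Type) (f : X -> Y) n :
  loc_const f -> loc_const (fun T => f (iter n (@sigma_shift I A F s) T)).
Proof.
elim: n f => [//|n IH] f hf; apply: (IH (fun T => f (sigma_shift T))).
by move=> T; have [r hr] := hf (sigma_shift T); exists r.+1 => T' /shift_agree /hr.
Qed.

Lemma admitted_closed : closed (admitted_space F s : set (full_shift A)).
Proof.
move=> T hT i l.
have : nbhs T [set T' : full_shift A | subword T i l = subword T' i l].
  apply/nbhs_full_shift; exists (absz i + l)%N => T' h.
  rewrite /= /subword /mkseq; apply/eq_in_map => k; rewrite mem_iota => kl.
  by apply: h; lia.
by move=> /hT[T' [hT' /= ->]]; exact: hT'.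
Qed.

Lemma loc_const_uniform (Y : Type) (f : X -> Y) :
  compact (admitted_space F s : set (full_shift A)) -> loc_const f ->
  exists r, forall T T', agreeX r T T' -> f T = f T'.
Proof.
move=> /compact_near_coveringP cpt hf.
pose P (r : nat) (x : full_shift A) := forall T T' : X,
  agree r 0 x (\val T) -> agree r 0 x (\val T') -> f T = f T'.
have : \forall n \near \oo, admitted_space F s `<=` P n.
  apply: cpt => x hx; have [r hr] := hf (exist _ x (mem_set hx)).
  exists ([set x' | agree r 0 x x'], [set n | (r <= n)%N]).
    by split; [apply/nbhs_full_shift; exists r|exists r].
  move=> [x' n] /= [h rn]; have H T0 : agree n 0 x' (\val T0) ->
      f (exist _ x (mem_set hx)) = f T0.
    by move=> h0; apply: hr => i hi; rewrite /= h ?h0 //; lia.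
  by move=> T T' /H <- /H <-.
move=> [r _ /(_ r (leqnn r)) hr]; exists r => T T' h.
by apply: (hr (\val T)) => //; exact: set_mem (valP T).
Qed.

End ShiftTopology.

Lemma admitted_compact (I : Type) (F : I -> subst letter) (s : nat -> I) :
  compact (admitted_space F s : set (full_shift letter)).
Proof.
apply: (subclosed_compact (@admitted_closed _ _ F s)); last first.
  exact: (@subsetT _ (admitted_space F s : set (full_shift letter))).
have /(tychonoff (I := int) (T := fun=> discrete_topology letter)) :
    forall i : int, compact [set: discrete_topology letter].
  by move=> _; apply: finite_compact; exact: (@finite_finset bool setT).
by congr compact; apply/seteqP; split.
Qed.

Lemma dirlim_piB (D : dirsys) i (x y : ds_grp i) :
  @dirlim_pi D i (x - y) = dirlim_pi x - dirlim_pi y.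
Proof.
symmetry; transitivity (dirlim_add (dirlim_pi x) (dirlim_opp (dirlim_pi y))) => //.
by rewrite dirlim_oppE dirlim_addE.
Qed.

(** * Functions modulo coboundaries *)

Section Cohomologous.
Context (I : Type) (A : choiceType) (F : I -> subst A) (s : nat -> I).
Local Notation X := (sigma_space F s).

Definition translate (k : int) (T : int -> A) : full_shift A := fun i => T (i + k).

Lemma admitted_translate (T : full_shift A) k :
  admitted_space F s T -> admitted_space F s (translate k T).
Proof.
move=> hT i l; have [n [c h]] := hT (i + k) l; exists n, c.
suff -> : subword (translate k T) i l = subword T (i + k) l by [].
by apply: eq_mkseq => m; rewrite /translate addrAC.
Qed.

Definition sigma_translate (k : int) (T : X) : X :=
  exist _ (translate k (\val T)) (mem_set (admitted_translate k (set_mem (valP T)))).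

Lemma sigma_inj (T T' : X) : (forall i, \val T i = \val T' i) -> T = T'.
Proof. by move=> h; apply/val_inj/funext. Qed.

Lemma iter_shiftE n (T : X) i : \val (iter n (@sigma_shift I A F s) T) i = \val T (i + n%:Z).
Proof.
elim: n i => [|n IH] i; first by rewrite addr0.
by rewrite iterS -[LHS]/(\val (iter n _ T) (i + 1)) IH -addrA -PoszD.
Qed.

Lemma shift_translate (T : X) : sigma_shift (sigma_translate (- 1)%R T) = T.
Proof.
apply: sigma_inj => i; rewrite /= /Defs.shift /translate.
by rewrite addrK.
Qed.

Lemma shift_inj : injective (@sigma_shift I A F s).
Proof.
move=> T T' e; apply: sigma_inj => i.
have := congr1 (fun U : X => \val U (i - 1)%R) e.
by rewrite /= /Defs.shift subrK.
Qed.

Lemma iter_shift_surj n (T : X) : exists T', iter n (@sigma_shift I A F s) T' = T.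
Proof.
exists (sigma_translate (- n%:Z)%R T); apply: sigma_inj => i.
by rewrite iter_shiftE /= /translate addrK.
Qed.

Definition cohom (f g : X -> int) : Prop :=
  exists2 k : X -> int, loc_const k & forall T, f T - g T = k T - k (sigma_shift T).

Lemma cohom_refl f : cohom f f.
Proof. by exists (fun=> 0) => [T|T]; [exists 0%N|rewrite !subrr]. Qed.

Lemma cohom_ext f g : f =1 g -> cohom f g.
Proof. by move=> /funext ->; exact: cohom_refl. Qed.

Lemma cohomZ a f g : cohom f g -> cohom (fun T => a * f T) (fun T => a * g T).
Proof.
move=> [k hk e]; exists (fun T => a * k T); first exact: loc_const_comp hk.
by move=> T; rewrite -!mulrBr e.
Qed.

Lemma cohomD f f' g g' : cohom f g -> cohom f' g' ->
  cohom (fun T => f T + f' T) (fun T => g T + g' T).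
Proof.
move=> [k hk e] [k' hk' e']; exists (fun T => k T + k' T).
  exact: loc_const2.
by move=> T; rewrite opprD addrACA e e' opprD addrACA.
Qed.

Lemma cohomB f f' g g' : cohom f g -> cohom f' g' ->
  cohom (fun T => f T - f' T) (fun T => g T - g' T).
Proof.
move=> h /(cohomZ (-1)) h'; have [k hk e] := cohomD h h'; exists k => // T.
by rewrite -e !mulN1r.
Qed.

Lemma cohom_sym f g : cohom f g -> cohom g f.
Proof.
move=> /(cohomZ (-1))[k hk e]; exists k => // T.
by rewrite -e !mulN1r opprK addrC.
Qed.

Lemma cohom_trans g f h : cohom f g -> cohom g h -> cohom f h.
Proof.
move=> hfg hgh; have [k hk e] := cohomD hfg hgh; exists k => // T.
by rewrite -e; ring.
Qed.

Lemma cohom_sum (J : Type) (r : seq J) (f g : J -> X -> int) :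
  (forall j, cohom (f j) (g j)) ->
  cohom (fun T => \sum_(j <- r) f j T) (fun T => \sum_(j <- r) g j T).
Proof.
move=> h; elim: r => [|j r IH].
  by apply: cohom_ext => T; rewrite !big_nil.
have [k hk e] := cohomD (h j) IH; exists k => // T.
by rewrite !big_cons -e.
Qed.

Lemma cohom_iter n f : loc_const f ->
  cohom f (fun T => f (iter n (@sigma_shift I A F s) T)).
Proof.
move=> hf; elim: n => [|n IH]; first exact: cohom_refl.
apply: (cohom_trans IH); exists (fun T => f (iter n (@sigma_shift I A F s) T)).
  exact: loc_const_shift.
by move=> T; rewrite -iterSr iterS.
Qed.

(** The members of the family are translates of one another by powers of the shift, so [cohom_iter]
    relates them. *)
Lemma cohom_family (f : int -> X -> int) :
  (forall j, loc_const (f j)) -> (forall j T, f j (sigma_shift T) = f (j + 1) T) ->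
  forall j j', cohom (f j) (f j').
Proof.
move=> lc fS; have H n j : cohom (f j) (f (j + n%:Z)).
  have := cohom_iter n (lc j); congr cohom; apply/funext => T.
  elim: n j => [|n IH] j; first by rewrite addr0.
  by rewrite iterS fS IH -addrA -PoszD.
move=> j j'; case: (lerP j j') => h.
  by have := H (absz (j' - j)%R) j; congr (cohom _ (f _)); lia.
by apply: cohom_sym; have := H (absz (j - j')%R) j'; congr (cohom _ (f _)); lia.
Qed.

End Cohomologous.

Definition ind (P : Prop) : int := (`[< P >] : nat)%:Z.

Lemma ind1 P : P -> ind P = 1.
Proof. by move=> p; rewrite /ind asboolT. Qed.

Lemma ind0 P : ~ P -> ind P = 0.
Proof. by move=> p; rewrite /ind asboolF. Qed.

Lemma ind_iff P Q : (P <-> Q) -> ind P = ind Q.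
Proof. by move=> /propext ->. Qed.

Lemma reads_count len (O : marking) (j : int) u c : tiling len O -> reads len O j u ->
  (forall c, 0 < len c)%N ->
  \sum_(i < wlen len u) ind (O (j + i%:Z) c) = (count_mem c u)%:Z.
Proof.
move=> til + pos; elim: u j => [|d u IH] j; first by rewrite big_ord0.
move=> [hd /IH e]; rewrite big_split_ord /= PoszD -e; congr (_ + _).
  have pd := pos d; rewrite (bigD1 (Ordinal pd)) //= addr0 big1 ?addr0.
    rewrite /ind; congr (nat_of_bool _)%:Z.
    apply/asboolP/eqP => [h|<- //].
    by have [_ <-] := tiling_uniq til h hd (lexx _) ltac:(have := pos c; lia).
  move=> i ni; apply: ind0 => h.
  have [h' _] := tiling_uniq til hd h ltac:(lia) ltac:(have := ltn_ord i; lia).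
  by move/eqP: ni; apply; apply/val_inj => /=; lia.
by apply: eq_bigr => i _; rewrite PoszD addrA.
Qed.

Lemma reads_determined len (O O' : marking) (j i : int) u c :
  tiling len O -> reads len O j u -> reads len O' j u ->
  j <= i < j + (wlen len u)%:Z -> O i c -> O' i c.
Proof.
move=> til; elim: u j => [|d u IH] j /=; first by rewrite /wlen /=; lia.
rewrite wlen_cons => -[h1 h2] [h1' h2'] hi hO.
case: (ltrP i (j + (len d)%:Z)) => h.
  by have [<- <-] := tiling_uniq til h1 hO ltac:(lia) h.
by apply: IH h2 h2' _ hO; lia.
Qed.

(** * Locally constant functions modulo coboundaries *)

Section LevelFunctions.
Context (s : nat -> 'I_3) (hnd : ~ degenerate s).
Local Notation X := (sigma_space psi s).
Local Notation sg := (@sigma_shift 'I_3 letter psi s).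

Definition occX n (j : int) c (T : X) : Prop := occ s n (\val T) j c.

Definition pairX n (j : int) c r (T : X) : Prop :=
  occX n j c T /\ occX n (j + (llen s n c)%:Z) r T.

Definition tile n j c (T : X) : int := ind (occX n j c T).

Definition tile2 n j c r (T : X) : int := ind (pairX n j c r T).

Lemma tilingX n (T : X) : tiling (llen s n) (fun j c => occX n j c T).
Proof. exact: occ_tiling (set_mem (valP T)). Qed.

Lemma occX_uniq n j c d T : occX n j c T -> occX n j d T -> c = d.
Proof.
move=> h h'; have := llen_gt0 s n c => pc.
by have [_] := tiling_uniq (tilingX n T) h h' (lexx _) ltac:(lia).
Qed.

Lemma occX_iter n j c i (T : X) :
  occX n j c (iter i sg T) <-> occX n (j + i%:Z) c T.
Proof.
have e : \val (iter i sg T) = (fun k => \val T (k + i%:Z)).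
  by apply/funext => k; rewrite iter_shiftE.
by rewrite /occX e; exact: occ_shift.
Qed.

Lemma pairX_iter n j c r i (T : X) :
  pairX n j c r (iter i sg T) <-> pairX n (j + i%:Z) c r T.
Proof. by rewrite /pairX !occX_iter addrAC. Qed.

Lemma occX_loc_const n j c : loc_const (fun T : X => `[< occX n j c T >]).
Proof.
move=> T; have [r hr] := occ_local s n; exists (absz j + r)%N => T' h.
congr asbool; apply/propext; apply: hr; apply: agree_sub h _ _; lia.
Qed.

Lemma tile_loc_const n j c : loc_const (tile n j c).
Proof. exact: (loc_const_comp (fun b : bool => (b : nat)%:Z) (occX_loc_const n j c)). Qed.

Lemma tile2_loc_const n j c r : loc_const (tile2 n j c r).
Proof.
have h := loc_const2 (fun b b' : bool => (b && b' : nat)%:Z) (occX_loc_const n j c)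
  (occX_loc_const n (j + (llen s n c)%:Z) r).
by move=> T; have [m hm] := h T; exists m => T' /hm; rewrite /tile2 /ind !asbool_and.
Qed.

Lemma tile2_cohom n j j' c r : cohom (tile2 n j c r) (tile2 n j' c r).
Proof.
apply: (cohom_family (f := fun j => tile2 n j c r)) => [i|i T].
  exact: tile2_loc_const.
by apply: ind_iff; exact: (pairX_iter n i c r 1).
Qed.

Lemma tile_next n j c T : tile n j c T = tile2 n j c la T + tile2 n j c lb T.
Proof.
have [h|h] := pselect (occX n j c T); last first.
  by rewrite /tile /tile2 !ind0 // => -[].
have [[] hd] := tiling_next (tilingX n T) h; rewrite /tile ind1 //.
  rewrite /tile2 ind0 ?ind1 // => -[_ h'].
  by have := occX_uniq h' hd.
rewrite /tile2 ind1 ?ind0 // => -[_ h'].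
by have := occX_uniq h' hd.
Qed.

Lemma tile_prev n j r T : tile n j r T =
  tile2 n (j - (llen s n la)%:Z) la r T + tile2 n (j - (llen s n lb)%:Z) lb r T.
Proof.
have [h|h] := pselect (occX n j r T); last first.
  by rewrite /tile /tile2 !ind0 // => -[_]; rewrite subrK.
have lp := llen_gt0 s n.
(* Two tiles that both end at [j] overlap, so there is only one predecessor even though the two
   lengths may differ. *)
have excl c d : occX n (j - (llen s n c)%:Z) c T ->
    occX n (j - (llen s n d)%:Z) d T -> c = d.
  have := lp c; have := lp d => ld lc hc hd.
  case: (lerP (llen s n d)%:Z (llen s n c)%:Z) => l.
    by have [] := tiling_uniq (tilingX n T) hc hd ltac:(lia) ltac:(lia).
  by have [] := tiling_uniq (tilingX n T) hd hc ltac:(lia) ltac:(lia).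
rewrite {1}/tile ind1 // /tile2 /pairX !subrK.
have [[] hd] := tiling_prev (tilingX n T) h.
  by rewrite ind0 ?ind1 // => -[h' _]; have := excl _ _ hd h'.
by rewrite ind1 ?ind0 // => -[h' _]; have := excl _ _ hd h'.
Qed.

(* Functions of the form x c + y r lie in the kernel of discr. *)
Definition discr (V : letter -> letter -> int) : int :=
  V la lb + V lb la - V la la - V lb lb.

(* Summing tile2 a _ over the next tile, or tile2 _ a over the previous one,
   yields tile a up to a coboundary; so tile2 b a and tile2 a b are cohomologous. *)
Lemma tile2_expansion n (V : letter -> letter -> int) :
  cohom (fun T => \sum_(c : bool) \sum_(r : bool) V c r * tile2 n 0 c r T)
    (fun T => discr V * tile2 n 0 la lb T +
      (V la la * tile n 0 la T + V lb lb * tile n 0 lb T)).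
Proof.
have [k hk e] : cohom (tile2 n 0 lb la) (tile2 n 0 la lb).
  have h : cohom (tile n 0 la) (fun T => tile2 n 0 la la T + tile2 n 0 lb la T).
    apply: (@cohom_trans _ _ _ _ (fun T => tile2 n (0 - (llen s n la)%:Z) la la T +
                             tile2 n (0 - (llen s n lb)%:Z) lb la T)).
      by apply: cohom_ext => T; exact: tile_prev.
    by apply: cohomD; exact: tile2_cohom.
  have [k hk e] := cohom_sym h; exists k => // T; rewrite -e /= tile_next; ring.
(* Once each [tile] is split by its successor, the two sides differ by [V lb la - V lb lb] times the
   difference of [tile2 lb la] and [tile2 la lb]. *)
exists (fun T => (V lb la - V lb lb) * k T); first exact: loc_const_comp hk.
move=> T; rewrite -mulrBr -e !big_bool /= !tile_next /discr /la /lb; ring.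
Qed.

Lemma tile_partition n (T : X) :
  \sum_(c : bool) \sum_(i < llen s n c) tile n (- (i : nat)%:Z) c T = 1.
Proof.
have [c [i [ic h]]] := tiling_cover (tilingX n T) 0.
rewrite sub0r in h.
have u d (j : nat) : (j < llen s n d)%N -> occX n (- j%:Z) d T -> j = i /\ d = c.
  move=> jd h'; case: (leqP i j) => ij.
    by have [] := tiling_uniq (tilingX n T) h' h ltac:(lia) ltac:(lia); split => //; lia.
  by have [] := tiling_uniq (tilingX n T) h h' ltac:(lia) ltac:(lia); split => //; lia.
rewrite (bigD1 c) //= (bigD1 (Ordinal ic)) //= {1}/tile ind1 //.
rewrite big1 => [|j /eqP ji].
  rewrite big1 ?addr0 // => d /eqP dc; apply: big1 => j _; apply: ind0 => h'.
  by have [_] := u _ _ (ltn_ord j) h'.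
apply: ind0 => h'; have [e _] := u _ _ (ltn_ord j) h'.
by apply: ji; exact/val_inj.
Qed.

Definition tile_determined n (f : X -> int) : Prop :=
  forall c r T T', pairX n 0 c r T -> pairX n 0 c r T' ->
    forall i, (i < llen s n c)%N -> f (iter i sg T) = f (iter i sg T').

Definition tile_sum n (Tw : letter -> letter -> X) (f : X -> int) c r : int :=
  \sum_(i < llen s n c) f (iter i sg (Tw c r)).

(** Multiplied by the partition of unity, [f] becomes a combination with constant coefficients of
    translated pair indicators. Moving them all to position 0 costs a coboundary and collects the
    coefficients into [tile_sum]. *)
Lemma tile_expansion n f Tw : (forall c r, pairX n 0 c r (Tw c r)) ->
  tile_determined n f ->
  cohom f (fun T => discr (tile_sum n Tw f) * tile2 n 0 la lb T +
    (tile_sum n Tw f la la * tile n 0 la T + tile_sum n Tw f lb lb * tile n 0 lb T)).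
Proof.
move=> hTw hf; apply: cohom_trans (tile2_expansion n _).
pose g c r (i : nat) := f (iter i sg (Tw c r)).
apply: (@cohom_trans _ _ _ _ (fun T => \sum_(c <- index_enum bool)
    \sum_(r <- index_enum bool) \sum_(i <- index_enum 'I_(llen s n c))
    g c r i * tile2 n (- (i : nat)%:Z) c r T)).
  apply: cohom_ext => T; rewrite -[LHS]mul1r -(tile_partition n T) mulr_suml.
  apply: eq_bigr => c _; rewrite exchange_big mulr_suml; apply: eq_bigr => i _.
  rewrite tile_next big_bool mulrDl addrC.
  have H r : tile2 n (- (i : nat)%:Z) c r T * f T =
      g c r i * tile2 n (- (i : nat)%:Z) c r T.
    have [h|h] := pselect (pairX n (- (i : nat)%:Z) c r T); last first.
      by rewrite /tile2 ind0 // mul0r mulr0.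
    rewrite mulrC; congr (_ * _); have [T' e] := iter_shift_surj i T.
    rewrite -e; apply: hf (hTw c r) _ (ltn_ord i).
    by move: h; rewrite -e pairX_iter addNr.
  by rewrite !H.
apply: (@cohom_trans _ _ _ _ (fun T => \sum_(c <- index_enum bool)
    \sum_(r <- index_enum bool) \sum_(i <- index_enum 'I_(llen s n c))
    g c r i * tile2 n 0 c r T)).
  apply: cohom_sum => c; apply: cohom_sum => r; apply: cohom_sum => i.
  by apply: cohomZ; exact: tile2_cohom.
apply: cohom_ext => T; apply: eq_bigr => c _; apply: eq_bigr => r _.
by rewrite -mulr_suml.
Qed.

Lemma pairX_exists n c r : exists T : X, pairX n 0 c r T.
Proof.
have [T hT] := admitted_exists hnd; have [j [h1 h2]] := occ_pair hnd n c r hT.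
exists (exist _ (translate j T) (mem_set (admitted_translate j hT))).
split; apply/occ_shift; first by rewrite add0r.
by rewrite add0r addrC.
Qed.

Lemma pairX_witnesses n : exists Tw, forall c r, pairX n 0 c r (Tw c r).
Proof.
have [f hf] := choice (fun p : letter * letter => pairX_exists n p.1 p.2).
by exists (fun c r => f (c, r)) => c r; exact: (hf (c, r)).
Qed.

Lemma occX_letters n (T : X) c i : occX n 0 c T -> (i < llen s n c)%N ->
  \val T i%:Z = nth la (lword s n c) i.
Proof. by move=> h hi; have := occ_letters h hi; rewrite add0r. Qed.

Lemma pairX_letters n (T : X) c r i : pairX n 0 c r T ->
  (i < llen s n c + llen s n r)%N ->
  \val T i%:Z = nth la (lword s n c ++ lword s n r) i.
Proof.
move=> [h1 h2] hi; rewrite nth_cat size_lword; case: ltnP => ic.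
  exact: occX_letters.
have := occ_letters h2 (i := i - llen s n c) ltac:(lia).
by rewrite add0r => <-; congr (set_val T _); lia.
Qed.

(** The bound has a [.+1] because a window starting at the last letter of the first tile still ends
    within the second. *)
Lemma window_tile_determined n l (f : X -> int) :
  (forall T T' : X, (forall i, (i < l)%N -> \val T i%:Z = \val T' i%:Z) -> f T = f T') ->
  (forall c, l <= (llen s n c).+1)%N -> tile_determined n f.
Proof.
move=> hf hl c r T T' h h' i ic; apply: hf => k kl.
have := hl r => lr.
by rewrite !iter_shiftE -PoszD (pairX_letters h) ?(pairX_letters h') //; lia.
Qed.

(** Tiles of level 0 are letters, so this generator of the extra summand does not depend on a level,
    unlike [tile2 n 0 la lb]. *)
Definition seam (T : X) : int := tile2 0 0 la lb T.

Lemma seamE T : seam T = ((\val T 0 == la) && (\val T 1 == lb) : nat)%:Z.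
Proof.
rewrite /seam /tile2 /ind; congr (nat_of_bool _)%:Z.
by apply/asboolP/andP => [[/= -> ]|[/eqP h1 /eqP h2]]; rewrite ?add0r // => ->.
Qed.

Lemma seam_window (T T' : X) : (forall i, (i < 2)%N -> \val T i%:Z = \val T' i%:Z) ->
  seam T = seam T'.
Proof. by move=> h; rewrite !seamE (h 0%N) // (h 1%N). Qed.

(** Occurrences of [ab] inside a tile [c] depend on [c] alone and are killed by [discr]. An
    occurrence across the boundary needs a first tile ending in [a] and a second tile [b]. Exactly
    one label [c] ends in [a]; the value is 1 if it is [a] and -1 if it is [b]. *)
Lemma seam_discr n Tw : (forall c r, pairX n 0 c r (Tw c r)) ->
  discr (tile_sum n Tw seam) = 1 \/ discr (tile_sum n Tw seam) = -1.
Proof.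
move=> hTw; pose ns c (i : nat) : int :=
  ((nth la (lword s n c) i == la) && (nth la (lword s n c) i.+1 == lb) : nat)%:Z.
pose inner c := \sum_(i < (llen s n c).-1) ns c i.
have E c r : tile_sum n Tw seam c r =
    inner c + ((c (+) left_letter s n == la) && (r == lb) : nat)%:Z.
  rewrite /tile_sum; have pc := llen_gt0 s n c; have pr := llen_gt0 s n r.
  have L (i : nat) : (i < llen s n c)%N -> seam (iter i sg (Tw c r)) =
     ((nth la (lword s n c ++ lword s n r) i == la) &&
      (nth la (lword s n c ++ lword s n r) i.+1 == lb) : nat)%:Z.
    move=> ic; rewrite seamE !iter_shiftE add0r -PoszD.
    by rewrite !(pairX_letters (hTw c r)) //; lia.
  rewrite -[in LHS](prednK pc) big_ord_recr /=; congr (_ + _).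
    apply: eq_bigr => i _; have hi := ltn_ord i; rewrite L; last by lia.
    have l1 : (i < llen s n c)%N by lia.
    have l2 : (i.+1 < llen s n c)%N by lia.
    by rewrite /ns !nth_cat size_lword l1 l2.
  rewrite L; last by lia.
  rewrite !nth_cat size_lword prednK // leqnn ltnn subnn.
  have -> : nth la (lword s n c) (llen s n c).-1 = c (+) left_letter s n.
    by rewrite -last_lword -size_lword nth_last; case: lword.
  have [u hu] : exists u, lword s n r = r :: u.
    elim: n {hTw ns inner pc pr L} r => [|n IH] r; first by exists [::].
    have [u hu] := IH r; have [v hv] := psi_cons (s n) r.
    by rewrite lwordS hv /subst_word /= hu; eexists.
  by rewrite hu.
rewrite /discr !E; case: (left_letter s n) => /=; [right|left]; ring.
Qed.

End LevelFunctions.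

(** * The direct limit and the functions it represents *)

Section Weights.
Context (s : nat -> 'I_3) (hnd : ~ degenerate s).
Local Notation X := (sigma_space psi s).
Local Notation sg := (@sigma_shift 'I_3 letter psi s).
Local Notation fB := (fun n => mulmx (matB (s n)) : {additive 'cV[int]_2 -> 'cV[int]_2}).
Local Notation lim := (seqlim_map fB).

(* In the coordinates (f_b, f_a + f_b) of Z^2 the transpose of the abelianized
   substitution psi_i is B_i. *)
Definition wt (v : 'cV[int]_2) (c : letter) : int :=
  if c then v 0 0 else v 1 0 - v 0 0.

Definition wtw v (u : seq letter) : int := \sum_(c <- u) wt v c.

Lemma wtB v v' c : wt (v - v') c = wt v c - wt v' c.
Proof. by rewrite /wt !mxE; case: c => //; ring. Qed.

Lemma wt_eq0 v : (forall c, wt v c = 0) -> v = 0.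
Proof.
move=> h; have := h la; have := h lb; rewrite /wt /= => h0.
rewrite h0 subr0 => h1; apply/matrixP => i j; rewrite mxE.
rewrite (ord1 j); case: i => -[|[|//]] hi.
  by rewrite -[RHS]h0; congr (v _ _); exact/val_inj.
by rewrite -[RHS]h1; congr (v _ _); exact/val_inj.
Qed.

Lemma wt_exists (x y : int) : exists v, wt v la = x /\ wt v lb = y.
Proof.
exists (\matrix_(i, j) if i == 0 then y else x + y).
by rewrite /wt /= !mxE /=; split => //; ring.
Qed.

Lemma wt_matB i v c : wt (matB i *m v) c = wtw v (psi i c).
Proof.
rewrite /wt /wtw !mxE !big_ord_recl !big_ord0 !mxE /=.
have -> : lift ord0 ord0 = 1 :> 'I_2 by exact/val_inj.
by case: i c => -[|[|[|//]]] ? []; rewrite /psi /= !big_cons big_nil /wt /=; ring.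
Qed.

Lemma wtw_matB i v u : wtw (matB i *m v) u = wtw v (subst_word (psi i) u).
Proof.
elim: u => [|c u IH]; first by rewrite /wtw !big_nil.
by rewrite /wtw /= big_cons big_cat /= -!/(wtw _ _) IH wt_matB.
Qed.

Lemma wtw_count v u : wtw v u = \sum_(d : bool) wt v d * (count_mem d u)%:Z.
Proof.
rewrite big_bool /wtw; elim: u => [|c u IH]; first by rewrite big_nil !mulr0.
by rewrite big_cons IH /=; case: c => /=; rewrite ?add0n ?add1n; ring.
Qed.

Lemma limS n k v : lim n (n + k.+1) v = matB (s (n + k)) *m lim n (n + k) v.
Proof. by rewrite /seqlim_map !addKn -(addn1 k) iotaD foldl_cat. Qed.

(** The witness is [u] inflated through the [k] intermediate substitutions. Inflating a word and
    moving the vector up the limit are dual operations, hence the equality of weights. *)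
Lemma descend n k u : exists w,
  [/\ wlen (llen s n) w = wlen (llen s (n + k)) u,
      forall v, wtw v w = wtw (lim n (n + k) v) u &
      forall T j, reads (llen s (n + k)) (occ s (n + k) T) j u ->
        reads (llen s n) (occ s n T) j w].
Proof.
elim: k u => [|k IH] u.
  exists u; rewrite addn0; split => // v.
  by rewrite /seqlim_map subnn.
have [w [h1 h2 h3]] := IH (subst_word (psi (s (n + k))) u); exists w; split.
- by rewrite h1 addnS wlen_subst.
- by move=> v; rewrite h2 limS wtw_matB.
- by move=> T j; rewrite addnS => /reads_collapsed /h3.
Qed.

(** The function on the subshift that stands for the vector [v] at stage [n] of the limit. *)
Definition lvl n v (T : X) : int := \sum_(c : bool) wt v c * tile n 0 c T.

Lemma lvlB n v v' T : lvl n (v - v') T = lvl n v T - lvl n v' T.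
Proof. by rewrite /lvl !big_bool !wtB /=; ring. Qed.

Lemma lvl_loc_const n v : loc_const (lvl n v).
Proof.
have h : loc_const (fun T : X => wt v la * tile n 0 la T + wt v lb * tile n 0 lb T).
  exact: (loc_const2 (fun x y => wt v la * x + wt v lb * y)
    (tile_loc_const n 0 la) (tile_loc_const n 0 lb)).
move=> T; have [r hr] := h T; exists r => T' /hr e.
by rewrite /lvl !big_bool [LHS]addrC [RHS]addrC; exact: e.
Qed.

Lemma lvl_sum n v (T : X) w : reads (llen s n) (occ s n (\val T)) 0 w ->
  \sum_(i < wlen (llen s n) w) lvl n v (iter i sg T) = wtw v w.
Proof.
move=> h; rewrite wtw_count exchange_big; apply: eq_bigr => d _.
rewrite -mulr_sumr -(reads_count d (tilingX n T) h (llen_gt0 s n)).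
congr (_ * _); apply: eq_bigr => i _; apply: ind_iff; exact: occX_iter.
Qed.

Lemma lvl_determined n k v c (T T' : X) i :
  occX (n + k) 0 c T -> occX (n + k) 0 c T' -> (i < llen s (n + k) c)%N ->
  lvl n v (iter i sg T) = lvl n v (iter i sg T').
Proof.
move=> h h' ic; have [w [e1 _ e2]] := descend n k [:: c].
have hw := e2 (\val T) 0 (conj h I); have hw' := e2 (\val T') 0 (conj h' I).
rewrite wlen_cons addn0 in e1.
apply: eq_bigr => d _; congr (_ * _); apply: ind_iff; rewrite !occX_iter.
by split; [apply: (reads_determined (tilingX n T) hw hw')|
  apply: (reads_determined (tilingX n T') hw' hw)]; rewrite e1; lia.
Qed.

Lemma lvl_tile_sum n k v c (T : X) : occX (n + k) 0 c T ->
  \sum_(i < llen s (n + k) c) lvl n v (iter i sg T) = wt (lim n (n + k) v) c.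
Proof.
move=> h; have [w [e1 e2 e3]] := descend n k [:: c].
have := lvl_sum v (e3 (\val T) 0 (conj h I)).
by rewrite e1 e2 wlen_cons addn0 /wtw big_seq1.
Qed.

(** Over a tile of level [m] the function sums to the weight of [lim n m v] on its label, whatever
    the next tile is. So [discr] vanishes and the expansion has no pair term. *)
Lemma lvl_lim n m v : (n <= m)%N -> cohom (lvl n v) (lvl m (lim n m v)).
Proof.
move=> /subnKC <-; move: (m - n)%N => {m} k.
have [Tw hTw] := pairX_witnesses hnd (n + k).
have E c r : tile_sum (n + k) Tw (lvl n v) c r = wt (lim n (n + k) v) c.
  exact: lvl_tile_sum (hTw c r).1.
apply: cohom_trans (tile_expansion hTw _) _.
  by move=> c r T T' h h' i ic; exact: lvl_determined h.1 h'.1 ic.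
apply: cohom_ext => T; rewrite /discr !E /lvl big_bool /la /lb /=; ring.
Qed.

Definition gpi n (v : 'cV[int]_2) : G_alpha s :=
  @dirlim_pi (seq_dirsys fB) n v.

Lemma gpi_lim n m v : (n <= m)%N -> gpi n v = gpi m (lim n m v).
Proof. by move=> nm; symmetry; exact: (@dirlim_pi_map (seq_dirsys fB) n m nm v). Qed.

Lemma gpiB n v v' : gpi n (v - v') = gpi n v - gpi n v'.
Proof. exact: (@dirlim_piB (seq_dirsys fB)). Qed.

Lemma gpi_eq0 n v : gpi n v = 0 <-> exists2 m, (n <= m)%N & lim n m v = 0.
Proof.
split.
  have -> : (0 : G_alpha s) = gpi 0 0 by [].
  move=> /dirlim_piP[m [nm [m0 e]]]; exists m => //.
  by rewrite [LHS]e raddf0.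
move=> [m nm e]; rewrite (gpi_lim _ nm) e.
by symmetry; exact: (@dirlim_zeroE (seq_dirsys fB) m).
Qed.

(** A relation, so that neither the stage [n] nor the vector [v] has to be chosen canonically. *)
Definition represents (f : X -> int) (h : G_alpha s * int) : Prop :=
  exists n v, h.1 = gpi n v /\ cohom f (fun T => h.2 * seam T + lvl n v T).

Lemma representsB f f' h h' : represents f h -> represents f' h' ->
  represents (fun T => f T - f' T) (h - h').
Proof.
case: h h' => [g z] [g' z'] [n [v /= [-> hf]]] [n' [v' /= [-> hf']]].
pose m := maxn n n'; have nm : (n <= m)%N := leq_maxl n n'.
have nm' : (n' <= m)%N := leq_maxr n n'.
exists m, (lim n m v - lim n' m v'); split.
  by rewrite /= (gpi_lim _ nm) (gpi_lim _ nm') gpiB.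
have up k x y (l : (k <= m)%N) : cohom (fun T => x * seam T + lvl k y T)
    (fun T => x * seam T + lvl m (lim k m y) T).
  by apply: cohomD; [exact: cohom_refl|exact: lvl_lim].
apply: cohom_trans (cohomB (cohom_trans hf (up _ _ _ nm))
                           (cohom_trans hf' (up _ _ _ nm'))) _.
by apply: cohom_ext => T; rewrite lvlB /=; ring.
Qed.

Lemma represents_surj h : exists2 f, loc_const f & represents f h.
Proof.
have [n [v e]] := dirlim_surj h.1.
exists (fun T => h.2 * seam T + lvl n v T); last first.
  by exists n, v; split => //; exact: cohom_refl.
exact: (loc_const2 (fun x y => h.2 * x + y) (tile2_loc_const 0 0 la lb)
                   (lvl_loc_const n v)).
Qed.

Lemma represents0 f : represents f 0 -> cohom f (fun=> 0).
Proof.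
move=> [n [v [/esym /= /gpi_eq0[m nm e] hf]]].
apply: cohom_trans hf _; apply: (@cohom_trans _ _ _ _ (lvl n v)).
  by apply: cohom_ext => T; rewrite mul0r add0r.
apply: cohom_trans (lvl_lim v nm) _; rewrite e; apply: cohom_ext => T.
have w0 c : wt 0 c = 0 by rewrite /wt !mxE subr0; case: c.
by rewrite /lvl big1 // => c _; rewrite w0 mul0r.
Qed.

Lemma represents_total f : loc_const f -> exists h, represents f h.
Proof.
move=> hf; have [r hr] := loc_const_uniform (@admitted_compact _ psi s) hf.
have [n hn] := llen_large hnd (r + r).+2.
have [Tw hTw] := pairX_witnesses hnd n.
have exp g l : loc_const g -> (l <= (r + r).+2)%N -> (forall T T' : X,
    (forall i, (i < l)%N -> \val T i%:Z = \val T' i%:Z) -> g T = g T') ->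
    cohom g (fun T => discr (tile_sum n Tw g) * tile2 n 0 la lb T +
    (tile_sum n Tw g la la * tile n 0 la T + tile_sum n Tw g lb lb * tile n 0 lb T)).
  move=> hg hl gw; apply: tile_expansion hTw _.
  apply: window_tile_determined gw _ => c.
  by have := hn n c (leqnn n); lia.
(* Translation keeps the class and moves the window from [[-r, r]] to [[0, 2r]], where the words of
   a pair of tiles are read. *)
pose f' T := f (iter r sg T).
have w (T T' : X) : (forall i, (i < (r + r).+1)%N -> \val T i%:Z = \val T' i%:Z) ->
    f' T = f' T'.
  move=> h; apply: hr => i hi; rewrite !iter_shiftE.
  have -> : i + r%:Z = (absz (i + r%:Z)%R)%:Z by lia.
  by apply: h; lia.
have e1 := exp f' (r + r).+1 (loc_const_shift r hf) (leqnSn _) w.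
have e2 := exp (@seam s) 2%N (tile2_loc_const 0 0 la lb) ltac:(lia) (@seam_window s).
have d1 := seam_discr hTw; move: (discr (tile_sum n Tw (@seam s))) d1 e2 => d d1 e2.
(* As [d] is its own inverse, the expansion of [seam] can be solved for the pair indicator of level
   [n]; the tile terms this brings in are subtracted in [v] below. *)
have dd : d * d = 1 by case: d1 => ->; rewrite ?mulr1 ?mulrNN ?mulr1.
set D := discr _ in e1.
move: e1 e2; set p := tile_sum n Tw f'; set q := tile_sum n Tw (@seam s) => e1 e2.
have [v [va vb]] := wt_exists (p la la - D * d * q la la) (p lb lb - D * d * q lb lb).
exists (gpi n v, D * d), n, v; split => //=.
apply: cohom_trans (cohom_iter r hf) _; apply: cohom_trans e1 _.
have := cohomZ (D * d) (cohom_sym e2) => /(cohomD (cohom_refl (lvl n v))).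
move=> h; apply: cohom_trans (cohom_trans h _); apply: cohom_ext => T.
  rewrite /lvl big_bool va vb -{1}[D]mulr1 -dd /la /lb /=; ring.
by rewrite addrC.
Qed.

(** Summing over a tile [c] followed by [r'] gives the equations [E]. Applying [discr] removes both
    the weights and the differences of [K], so [z = 0]; the pairs [c c] then show that each weight
    vanishes. *)
Lemma represents_cohom0 f h : cohom f (fun=> 0) -> represents f h -> h = 0.
Proof.
case: h => g z f0 [n [v /= [-> hf]]].
have [k hk e] := cohom_trans (cohom_sym hf) f0.
pose p T := z * seam T + lvl n v T.
have {}e T : p T = k T - k (sg T) by rewrite -e /p subr0.
have sumk j T : \sum_(i < j) p (iter i sg T) = k T - k (iter j sg T).
  elim: j => [|j IH]; first by rewrite big_ord0 subrr.
  by rewrite big_ord_recr /= IH e; ring.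
have [r hr] := loc_const_uniform (@admitted_compact _ psi s) hk.
have [N hN] := llen_large hnd (r + r).+2.
pose m := (n + N)%N; have hm c := hN m c (leq_addl n N).
(* The window of [k] sticks out to the left of the tile. So [k T] is expressed by its value [r]
   steps later, whose window lies inside the tile, plus the values of [p] in between. *)
have kdet c (T T' : X) : occX m 0 c T -> occX m 0 c T' -> k T = k T'.
  move=> h h'; have lc := hm c.
  have L (i : nat) : (i < llen s m c)%N -> \val T i%:Z = \val T' i%:Z.
    by move=> ic; rewrite (occX_letters h ic) (occX_letters h' ic).
  have e1 := sumk r T; have e2 := sumk r T'.
  have kr : k (iter r sg T) = k (iter r sg T').
    apply: hr => i hi; rewrite !iter_shiftE.
    have -> : i + r%:Z = (absz (i + r%:Z)%R)%:Z by lia.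
    by apply: L; lia.
  have er : \sum_(i < r) p (iter i sg T) = \sum_(i < r) p (iter i sg T').
    apply: eq_bigr => i _; have ir := ltn_ord i.
    rewrite /p (lvl_determined v h h'); last by rewrite -/m; lia.
    congr (_ * _ + _); apply: seam_window => j j2.
    by rewrite !iter_shiftE -PoszD; apply: L; lia.
  by move: er; rewrite e1 e2 kr => /addIr.
have [Tw hTw] := pairX_witnesses hnd m.
pose K c := k (Tw c la).
have E c r' : z * tile_sum m Tw (@seam s) c r' + wt (lim n m v) c = K c - K r'.
  have := sumk (llen s m c) (Tw c r'); rewrite big_split /=.
  rewrite (lvl_tile_sum v (hTw c r').1) -mulr_sumr => ->.
  congr (_ - _); first exact: kdet (hTw c r').1 (hTw c la).1.
  by apply: kdet (hTw r' la).1; rewrite occX_iter; exact: (hTw c r').2.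
have z0 : z = 0.
  have : z * discr (tile_sum m Tw (@seam s)) = 0.
    have := E la la; have := E la lb; have := E lb la; have := E lb lb.
    rewrite /discr; move: (tile_sum _ _ _) (wt _) => V w h1 h2 h3 h4.
    have -> : z * (V la lb + V lb la - V la la - V lb lb) =
      (z * V la lb + w la) + (z * V lb la + w lb) - (z * V la la + w la) -
      (z * V lb lb + w lb) by ring.
    by rewrite h1 h2 h3 h4; ring.
  by case: (seam_discr hTw) => ->; rewrite ?mulr1 // mulrN1 => /eqP; rewrite oppr_eq0 => /eqP.
congr pair => //; apply/gpi_eq0; exists m; first exact: leq_addr.
by apply: wt_eq0 => c; have := E c c; rewrite z0 mul0r add0r subrr.
Qed.

End Weights.

(** * Cech classes of the suspension *)

Local Open Scope quotient_scope.

Section Suspension.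
Context (R : realType) (I : Type) (A : choiceType) (F : I -> subst A) (s : nat -> I).
Local Notation X := (sigma_space F s).
Local Notation S := (suspension R F s).
Local Notation Omega := (tiling_space R F s).
Local Notation glue := (@Defs.glue R I A F s).

Definition proj_tiling (p : S) : Omega :=
  \pi_({eq_quot (@glue_rel R I A F s)}) p.

Local Notation pj := proj_tiling.

Lemma proj_tiling_surj z : exists p, z = pj p.
Proof. by exists (repr (z : {eq_quot (@glue_rel R I A F s)})); rewrite /pj reprK. Qed.

Lemma proj_tiling_glue p q : glue p q -> pj p = pj q.
Proof. by move=> h; apply/eqquotP/asboolP; exact: Relation_Operators.rst_step. Qed.

Lemma proj_tiling_invariant (Z : Type) (h : S -> Z) :
  (forall p q, glue p q -> h p = h q) -> forall p q, pj p = pj q -> h p = h q.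
Proof.
move=> hg p q /eqquotP /asboolP; by elim=> {p q} // p q r _ -> _ ->.
Qed.

Definition close r (e : R) (p q : S) : Prop :=
  agreeX r p.1 q.1 /\ `|\val p.2 - \val q.2| < e.

Lemma nbhs_suspension (p : S) (B : set S) :
  nbhs p B <-> exists r e, 0 < e /\ forall q, close r e p q -> B q.
Proof.
split.
  move=> [[P Q] /= [/nbhs_sigma[r hr] [C [[D oD <-] /= Dt CQ]]] sub].
  have /nbhs_ballP[e /= e0 he] : nbhs (set_val p.2 : R) D.
    by apply: open_nbhs_nbhs; split.
  exists r, e; split => // q [h1 h2]; apply: sub; split; first exact: hr.
  by apply: CQ; apply: he.
move=> [r [e [e0 h]]].
exists ([set y | agreeX r p.1 y], [set t | `|\val p.2 - \val t| < e]).
  split; first by apply/nbhs_sigma; exists r.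
  have H : nbhs (set_val p.2 : R) (ball (set_val p.2 : R) e).
    exact: nbhsx_ballx.
  exact: (@initial_continuous _ _ (set_val : set_type `[0 : R, 1] -> R) p.2) H.
by move=> q [h1 h2]; apply: h.
Qed.

Lemma open_tilingP (u : set Omega) : open u <->
  forall p, u (pj p) -> exists r e, 0 < e /\ forall q, close r e p q -> u (pj q).
Proof.
have -> : open u = open (pj @^-1` u) by [].
rewrite openE; split.
  by move=> h p /h /nbhs_suspension.
by move=> h p /h /nbhs_suspension.
Qed.

Definition loc_const_at (Z : Type) (g : S -> Z) (p : S) : Prop :=
  exists r e, 0 < e /\ forall q, close r e p q -> g q = g p.

Lemma unit_point_subproof (t : R) : 0 <= t <= 1 -> t \in `[0, 1]%classic.
Proof. by move=> h; rewrite inE /= in_itv. Qed.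

Definition unit_point (t : R) (h : 0 <= t <= 1) : set_type `[0 : R, 1] :=
  exist _ t (unit_point_subproof h).

Lemma unit_pointP (t : set_type `[0 : R, 1]) : 0 <= \val t <= 1.
Proof. by have := set_mem (valP t); rewrite /= in_itv. Qed.

Lemma le001 : 0 <= (0 : R) <= 1. Proof. by rewrite lexx ler01. Qed.
Lemma le011 : 0 <= (1 : R) <= 1. Proof. by rewrite lexx ler01. Qed.

Local Notation J0 := (unit_point le001).
Local Notation J1 := (unit_point le011).

Lemma glueP (p q : S) : glue p q <-> exists x, p = (x, J1) /\ q = (sigma_shift x, J0).
Proof.
split; last by move=> [x [-> ->]].
case: p q => [x t] [y t'] [/= h1 h2 ->]; exists x.
by split; congr pair; exact: val_inj.
Qed.

(** A Lebesgue number argument in which [n] stands for the scale; compactness makes one scale serve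
    all [t]. *)
Lemma lebesgue_unit (K : nat -> R -> Prop) :
  (forall t, 0 <= t <= 1 -> exists e N, 0 < e /\
     forall n t', (N <= n)%N -> `|t - t'| < e -> K n t') ->
  exists n, forall t, 0 <= t <= 1 -> K n t.
Proof.
move=> h; have /compact_near_coveringP cpt := @segment_compact R 0 1.
have : \forall n \near \oo, `[0, 1]%classic `<=` K n.
  apply: cpt => t; rewrite /= in_itv /= => /h[e [N [e0 hK]]].
  exists (ball t e, [set n | (N <= n)%N]).
    by split; [exact: nbhsx_ballx|exists N].
  by move=> [t' n] /= [h1 h2]; exact: hK.
move=> [n _ /(_ n (leqnn n)) hn]; exists n => t ht; apply: hn.
by rewrite /= in_itv.
Qed.

Lemma inv_small (e : R) : 0 < e ->
  exists N, forall n, (N <= n)%N -> n.+1%:R^-1 < e.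
Proof.
move=> e0; exists (Num.truncn e^-1) => n hn.
rewrite invf_plt ?posrE //.
apply: lt_le_trans (truncnS_gt e^-1) _.
by rewrite ler_nat ltnS.
Qed.

Lemma frac_unit (n k : nat) : (k <= n.+1)%N -> 0 <= (k%:R / n.+1%:R : R) <= 1.
Proof.
by move=> h; rewrite divr_ge0 ?ler0n //= ler_pdivrMr ?ltr0n // mul1r ler_nat.
Qed.

(** Connectedness of the segment in discrete form: a chain of steps of length [1/(n+1)], none of
    which changes [g]. *)
Lemma loc_const_path (Z : Type) (g : S -> Z) x :
  (forall p, loc_const_at g p) -> g (x, J1) = g (x, J0).
Proof.
move=> hg; pose K (n : nat) (t : R) := forall a b : set_type `[0 : R, 1],
  \val a = t -> `|\val a - \val b| <= n.+1%:R^-1 -> g (x, a) = g (x, b).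
have [n hn] : exists n, forall t, 0 <= t <= 1 -> K n t.
  apply: lebesgue_unit => t ht; have [r [e [e0 he]]] := hg (x, unit_point ht).
  have [N hN] := inv_small (divr_gt0 e0 (ltr0n _ 2)).
  exists (e / 2), N; split; first by rewrite divr_gt0.
  move=> n t' /hN hn tt a b ea; rewrite ea => ab.
  have D := ler_distD t' t (\val b).
  have ca : close r e (x, unit_point ht) (x, a) by split=> //=; rewrite ea; lra.
  have cb : close r e (x, unit_point ht) (x, b).
    by split=> //; apply: le_lt_trans D _; rewrite [e]splitr ltrD // (le_lt_trans ab).
  by rewrite !he.
have H k : (k <= n.+1)%N -> forall h, g (x, unit_point (t := k%:R / n.+1%:R) h) = g (x, J0).
  elim: k => [|k IH] kn h.
    by congr (g (x, _)); apply: val_inj; rewrite /= mul0r.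
  have h' := frac_unit (ltnW kn); rewrite -(IH (ltnW kn) h').
  apply: (hn _ h) => //=; rewrite -mulrBl -natrB // subSnn mul1r ger0_norm //.
have := H n.+1 (leqnn _) (frac_unit (leqnn _)) => <-.
by congr (g (x, _)); apply: val_inj; rewrite /= divff.
Qed.

(** [h u] is a primitive of the cocycle over the part of the cylinder lying above [u]; elsewhere its
    values are irrelevant. It need not descend to the quotient: [phi] is its jump across the gluing,
    the same for all [u]. *)
Definition trivializes (U : open_cover Omega) (f : cech_Z1 U)
    (h : member U -> S -> int) (phi : X -> int) : Prop :=
  [/\ forall u p, mem_set_of u (pj p) -> loc_const_at (h u) p,
      forall u v p, mem_set_of u (pj p) -> mem_set_of v (pj p) ->
        cech_Z1_val f u v = h v p - h u p
    & forall u p q, glue p q -> mem_set_of u (pj p) ->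
        phi p.1 = h u p - h u q].

(* c is the class of the Z-torsor obtained from the trivial one over X * [0, 1]
   by gluing its two ends along phi. *)
Definition cech_represents (phi : X -> int) (c : cech_H1 Omega) : Prop :=
  exists (U : open_cover Omega) (f : cech_Z1 U) h,
    c = @dirlim_pi (cech_dirsys Omega) U (cech_class f) /\ trivializes f h phi.

Lemma cover_member (U : open_cover Omega) z : exists u : member U, mem_set_of u z.
Proof.
have [u Uu uz] : (\bigcup_(u in U) u) z by rewrite cover_full.
by exists (exist _ u (mem_set Uu)).
Qed.

Lemma member_open (U : open_cover Omega) (u : member U) : open (mem_set_of u).
Proof. exact: cover_open (set_mem (valP u)). Qed.

Lemma member_close (U : open_cover Omega) (u : member U) p : mem_set_of u (pj p) ->
  exists r e, 0 < e /\ forall q, close r e p q -> mem_set_of u (pj q).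
Proof. by move: p; apply/open_tilingP; exact: member_open. Qed.

Lemma cech_Z1_cocycle (U : open_cover Omega) (f : cech_Z1 U) u v w z :
  mem_set_of u z -> mem_set_of v z -> mem_set_of w z ->
  cech_Z1_val f u w = cech_Z1_val f u v + cech_Z1_val f v w.
Proof.
move=> hu hv hw; have /asboolP[_ /(_ u v w)] := valP f.
have e : mem_set_of u `&` mem_set_of v `&` mem_set_of w !=set0 by exists z.
move=> /(_ e) /=; lia.
Qed.

Lemma pullback_class (U W : open_cover Omega) (r : member W -> member U)
  (hr : is_refinement r) (f : cech_Z1 U) :
  @dirlim_pi (cech_dirsys Omega) W (cech_class (pullback_Z1 hr f)) =
  @dirlim_pi (cech_dirsys Omega) U (cech_class f).
Proof.
have h : refines U W by move=> w; exists (r w); exact: hr.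
by rewrite -(cech_H1_mapE h hr); exact: (@dirlim_pi_map (cech_dirsys Omega) U W h).
Qed.

Lemma trivializes_pullback (U W : open_cover Omega) (r : member W -> member U)
  (hr : is_refinement r) (f : cech_Z1 U) h phi :
  trivializes f h phi -> trivializes (pullback_Z1 hr f) (fun w => h (r w)) phi.
Proof.
move=> [h1 h2 h3]; split.
- by move=> u p up; apply: h1; exact: hr.
- move=> u v p up vp; rewrite pullback_Z1E; last by exists (pj p).
  by apply: h2; exact: hr.
- by move=> u p q g up; apply: h3 => //; exact: hr.
Qed.

Lemma trivializesB (U : open_cover Omega) (f f' : cech_Z1 U) h h' phi phi' :
  trivializes f h phi -> trivializes f' h' phi' ->
  trivializes (f - f') (fun u p => h u p - h' u p) (fun x => phi x - phi' x).
Proof.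
move=> [t1 t2 t3] [t'1 t'2 t'3]; split.
- move=> u p up; have [r1 [e1 [p1 c1]]] := t1 u p up.
  have [r2 [e2 [p2 c2]]] := t'1 u p up.
  exists (maxn r1 r2), (Num.min e1 e2); split; first by rewrite lt_min p1 p2.
  move=> q [ag]; rewrite lt_min => /andP[l1 l2].
  by rewrite c1 ?c2 //; split => //; apply: agreeX_le ag; rewrite ?leq_maxl ?leq_maxr.
- by move=> u v p up vp; rewrite cech_Z1_valB (t2 _ _ _ up vp) (t'2 _ _ _ up vp); ring.
- by move=> u p q pq up; rewrite (t3 _ _ _ pq up) (t'3 _ _ _ pq up); ring.
Qed.

Lemma cech_representsB phi phi' c c' :
  cech_represents phi c -> cech_represents phi' c' ->
  cech_represents (fun x => phi x - phi' x) (c - c').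
Proof.
move=> [U [f [h [-> t]]]] [U' [f' [h' [-> t']]]].
have [W [r r']] := refines_directed U U'.
rewrite -(pullback_class (refinementP r) f) -(pullback_class (refinementP r') f').
exists W, (pullback_Z1 (refinementP r) f - pullback_Z1 (refinementP r') f').
eexists; split; last exact: trivializesB (trivializes_pullback _ t) (trivializes_pullback _ t').
by rewrite raddfB; symmetry; exact: (@dirlim_piB (cech_dirsys Omega)).
Qed.

(** On a refinement the cocycle is the coboundary of some [g], so the functions [h u - g u] agree on
    overlaps and form one locally constant [k] on the cylinder. It is constant along segments, and
    its jump across the gluing is [phi]. *)
Lemma cech_represents0 phi : cech_represents phi 0 -> cohom phi (fun=> 0).
Proof.
move=> [U [f [h [/esym e t]]]].
have z0 : (0 : cech_H1 Omega) =
  @dirlim_pi (cech_dirsys Omega) (trivial_cover Omega) 0 by [].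
move: e; rewrite z0 => /dirlim_piP[W [hU [hT]]]; rewrite raddf0 /= => e.
have := trivializes_pullback (refinementP hU) t.
have : cech_class (pullback_Z1 (refinementP hU) f) = cech_class 0.
  by rewrite raddf0 -e; symmetry; exact: cech_H1_mapE.
move=> /cech_classP; rewrite subr0 => /asboolP[g].
move: (pullback_Z1 _ f) (fun w : member W => h (refinement hU w)) => {t e}f {}h.
move=> hg [t1 t2 t3].
have [m hm] := choice (fun p => cover_member W (pj p)).
pose k p := h (m p) p - g (m p).
have kE u p : mem_set_of u (pj p) -> k p = h u p - g u.
  move=> up; have /hg : mem_set_of u `&` mem_set_of (m p) !=set0.
    by exists (pj p); split => //; exact: hm.
  by rewrite (t2 _ _ _ up (hm p)) /k => e'; lia.
have kc p : loc_const_at k p.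
  have [r1 [e1 [p1 c1]]] := t1 _ _ (hm p); have [r2 [e2 [p2 c2]]] := member_close (hm p).
  exists (maxn r1 r2), (Num.min e1 e2); split; first by rewrite lt_min p1 p2.
  move=> q [ag]; rewrite lt_min => /andP[l1 l2].
  have q1 : close r1 e1 p q by split => //; apply: agreeX_le ag; rewrite leq_maxl.
  have q2 : close r2 e2 p q by split => //; apply: agreeX_le ag; rewrite leq_maxr.
  by rewrite (kE (m p) q (c2 _ q2)) c1.
exists (fun x => k (x, J0)) => x.
  have [r [e1 [e0 hc]]] := kc (x, J0); exists r => y xy; rewrite hc //.
  by split => //=; rewrite subrr normr0.
have gl : glue (x, J1) (sigma_shift x, J0) by apply/glueP; exists x.
rewrite -(loc_const_path x kc) subr0 (t3 _ _ _ gl (hm _)) (kE _ _ (hm _)).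
have hm' : mem_set_of (m (x, J1)) (pj (sigma_shift x, J0)).
  by rewrite -(proj_tiling_glue gl).
by rewrite (kE _ _ hm'); ring.
Qed.

Definition saturated (B : set S) : Prop := forall p q, glue p q -> B p <-> B q.

Lemma saturatedP B p : saturated B -> (pj @` B) (pj p) <-> B p.
Proof.
move=> sB; split; last by move=> Bp; exists p.
move=> [q Bq e]; have := proj_tiling_invariant (h := B) _ e.
by move=> <- // p1 q1 /sB /propext.
Qed.

Lemma saturated_open B : saturated B ->
  (forall p, B p -> exists r e, 0 < e /\ forall q, close r e p q -> B q) ->
  open (pj @` B).
Proof.
move=> sB oB; apply/open_tilingP => p /(saturatedP _ sB) /oB[r [e [e0 h]]].
by exists r, e; split => // q /h Bq; apply/saturatedP.
Qed.

(* If phi = k - k o shift then the trivialization corrected by k descends to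
   the tiling space, and its level sets refine the cover so as to make the
   cocycle a coboundary. *)
Lemma cech_represents_cohom0 (phi : X -> int) (c : cech_H1 Omega) : cohom phi (fun=> 0) ->
  cech_represents phi c -> c = 0.
Proof.
move=> [k hk e] [U [f [h [-> [t1 t2 t3]]]]].
pose h' u p := h u p - k p.1.
have h'glue u p q : glue p q -> mem_set_of u (pj p) -> h' u p = h' u q.
  move=> g up; have := t3 u p q g up; have := e p.1; case: g => _ _ e1.
  by rewrite subr0 /h' e1 => -> e2; rewrite -[h u p](subrK (h u q)) -e2; ring.
pose cell (u : member U) (n : int) : set S := [set p | mem_set_of u (pj p) /\ h' u p = n].
have sat u n : saturated (cell u n).
  move=> p q g; rewrite /cell /= -(proj_tiling_glue g).
  by split=> -[up <-]; split => //; rewrite (h'glue _ _ _ g).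
have opn u n : open (pj @` cell u n).
  apply: saturated_open => // p [up hp].
  have [r1 [e1 [p1 c1]]] := t1 _ _ up; have [r2 [e2 [p2 c2]]] := member_close up.
  have [r3 c3] := hk p.1.
  exists (r1 + r2 + r3)%N, (Num.min e1 e2); split; first by rewrite lt_min p1 p2.
  move=> q [ag]; rewrite lt_min => /andP[l1 l2]; split.
    by apply: c2; split => //; apply: agreeX_le ag; lia.
  rewrite -hp /h' c1; last by split => //; apply: agreeX_le ag; lia.
  by rewrite (c3 q.1) //; apply: agreeX_le ag; lia.
have full : \bigcup_(w in [set w | exists u n, w = pj @` cell u n]) w = [set: Omega].
  apply/seteqP; split => // z _; have [p ->] := proj_tiling_surj z.
  have [u up] := cover_member U (pj p).
  by exists (pj @` cell u (h' u p)); [exists u, (h' u p)|exists p].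
have opn' w : (exists u n, w = pj @` cell u n) -> open w by move=> [u [n ->]].
pose W := OpenCover opn' full.
(* Each member of [W] is a level set: [r] recovers its [u], and [g] the value of [h'] on it. *)
have [r hr] := choice (fun w : member W => set_mem (valP w)).
have [g hg] := choice hr.
have ref : is_refinement r.
  move=> w z wz; have := wz; rewrite {1}/mem_set_of hg => -[p [up _] <-].
  exact: up.
rewrite -(pullback_class ref f).
have -> : cech_class (pullback_Z1 ref f) = 0.
  rewrite -(raddf0 (@cech_class _ W)); apply/cech_classP; rewrite subr0.
  apply/asboolP; exists g => v w ne; rewrite pullback_Z1E //.
  case: ne => z [vz wz]; have [p ep] := proj_tiling_surj z.
  have cellP (x : member W) : mem_set_of x z -> cell (r x) (g x) p.
    by rewrite /mem_set_of hg ep => /saturatedP; apply.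
  have [vp ev] := cellP _ vz; have [wp ew] := cellP _ wz.
  by rewrite (t2 _ _ _ vp wp) -ev -ew /h'; ring.
by symmetry; exact: (@dirlim_zeroE (cech_dirsys Omega) W).
Qed.

Lemma translate_shift (T : X) : sigma_translate (- 1)%R (sigma_shift T) = T.
Proof. by apply: shift_inj; exact: shift_translate. Qed.

Lemma agreeX_translate r (T T' : X) : agreeX r.+1 T T' ->
  agreeX r (sigma_translate (- 1)%R T) (sigma_translate (- 1)%R T').
Proof. by move=> h i hi; rewrite /= /translate; apply: h; lia. Qed.

(* Two overlapping charts of the open cylinder and, for every value n of phi,
   a chart around the seam where the trivialization jumps by n. *)
Definition chart (phi : X -> int) (a : bool + int) : set S :=
  match a with
  | inl false => [set p | 0 < \val p.2 < 2 / 3]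
  | inl true => [set p | 1 / 3 < \val p.2 < 1]
  | inr n => [set p | (2 / 3 < \val p.2 /\ phi p.1 = n) \/
                      (\val p.2 < 1 / 3 /\ phi (sigma_translate (- 1)%R p.1) = n)]
  end.

(** Around the seam the value is [n] just before the gluing and 0 just after it, which produces the
    jump [phi]. The threshold 1/2 lies in the gap that these charts avoid. *)
Definition chart_val (a : bool + int) (p : S) : int :=
  if a is inr n then if 1 / 2 < \val p.2 then n else 0 else 0.

(** The default 0 is right: [inl false] meets [inr n] only below 1/3, where both values are 0, and
    [inr n] and [inr m] are disjoint unless [n = m]. *)
Definition chart_diff (a b : bool + int) : int :=
  match a, b with
  | inl true, inr n => n
  | inr n, inl true => - n
  | _, _ => 0
  end.

Lemma chart_diffP phi a b p : chart phi a p -> chart phi b p ->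
  chart_diff a b = chart_val b p - chart_val a p.
Proof.
case: a => [[]|n]; case: b => [[]|m] //=; rewrite ?subrr //.
- move=> /andP[h1 h2] [[h3 _]|[h3 _]]; last by exfalso; lra.
  by rewrite ifT ?subr0 //; lra.
- move=> /andP[h1 h2] [[h3 _]|[h3 _]]; first by exfalso; lra.
  by rewrite ifF ?subr0 //; apply/negbTE; rewrite -leNgt; lra.
- move=> [[h3 _]|[h3 _]] /andP[h1 h2]; last by exfalso; lra.
  by rewrite ifT ?sub0r //; lra.
- move=> [[h3 _]|[h3 _]] /andP[h1 h2]; first by exfalso; lra.
  by rewrite ifF ?subr0 //; apply/negbTE; rewrite -leNgt; lra.
- move=> [[h1 h2]|[h1 h2]] [[h3 h4]|[h3 h4]]; try by exfalso; lra.
    by rewrite -h2 -h4 subrr.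
  by rewrite -h2 -h4 subrr.
Qed.

Lemma chart_saturated phi a : saturated (chart phi a).
Proof.
move=> p q /glueP[x [-> ->]]; case: a => [[]|n] /=.
- by split=> /andP[]; lra.
- by split=> /andP[]; lra.
- rewrite translate_shift; split=> -[[h1 h2]|[h1 h2]].
  + by right; split => //; lra.
  + by exfalso; lra.
  + by exfalso; lra.
  + by left; split => //; lra.
Qed.

Lemma chart_open phi a : loc_const phi -> open (pj @` chart phi a).
Proof.
move=> hphi; apply: saturated_open; first exact: chart_saturated.
have near (p q : S) (e : R) : `|\val p.2 - \val q.2| < e ->
    \val p.2 - e < \val q.2 < \val p.2 + e by rewrite ltr_norml; lra.
move=> p; case: a => [[]|n] /=.
- move=> /andP[h1 h2]; exists 0%N, (Num.min (\val p.2 - 1 / 3) (1 - \val p.2)).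
  rewrite lt_min !subr_gt0 h1 h2; split => // q [_].
  by rewrite lt_min => /andP[/near l1 /near l2]; rewrite /= in l1 l2; lra.
- move=> /andP[h1 h2]; exists 0%N, (Num.min (\val p.2) (2 / 3 - \val p.2)).
  rewrite lt_min !subr_gt0 h1 h2; split => // q [_].
  by rewrite lt_min => /andP[/near l1 /near l2]; rewrite /= in l1 l2; lra.
- move=> [[h1 h2]|[h1 h2]].
    have [r hr] := hphi p.1; exists r, (\val p.2 - 2 / 3).
    rewrite subr_gt0 h1; split => // q [ag /near l]; rewrite /= in l; left; split; first by lra.
    by rewrite -hr.
  have [r hr] := hphi (sigma_translate (- 1)%R p.1); exists r.+1, (1 / 3 - \val p.2).
  rewrite subr_gt0 h1; split => // q [ag /near l]; rewrite /= in l; right; split; first by lra.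
  by rewrite -hr //; exact: agreeX_translate.
Qed.

Lemma cech_represents_surj (phi : X -> int) : loc_const phi ->
  exists c, cech_represents phi c.
Proof.
move=> hphi.
have n1 : ((1 : R) < 2 / 3) = false by lra.
have n2 : ((1 : R) < 1 / 3) = false by lra.
have n3 : ((1 / 2 : R) < 0) = false by lra.
have n4 : ((1 / 2 : R) < 1) = true by lra.
have full : \bigcup_(w in [set w | exists a, w = pj @` chart phi a]) w = [set: Omega].
  apply/seteqP; split => // z _; have [p ->] := proj_tiling_surj z.
  suff [a ha] : exists a, chart phi a p by exists (pj @` chart phi a); [exists a|exists p].
  have /andP[t0 t1] := unit_pointP p.2.
  case: (ltrP (\val p.2) (1 / 3)) => h1.
    by exists (inr (phi (sigma_translate (- 1)%R p.1))); right.
  case: (ltrP (2 / 3) (\val p.2)) => h2; first by exists (inr (phi p.1)); left.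
  case: (ltrP (\val p.2) (2 / 3)) => h3.
    by exists (inl false) => /=; rewrite /= in h1 h3; lra.
  by exists (inl true) => /=; rewrite /= in h2 h3; lra.
have opn w : (exists a, w = pj @` chart phi a) -> open w.
  by move=> [a ->]; exact: chart_open.
pose U := OpenCover opn full.
have [tag htag] := choice (fun w : member U => set_mem (valP w)).
have tagP u p : mem_set_of u (pj p) <-> chart phi (tag u) p.
  by rewrite /mem_set_of htag; apply: saturatedP; exact: chart_saturated.
pose f : cochain1 U := fun u v =>
  if `[< mem_set_of u `&` mem_set_of v !=set0 >] then chart_diff (tag u) (tag v) else 0.
have fE u v p : mem_set_of u (pj p) -> mem_set_of v (pj p) ->
    f u v = chart_val (tag v) p - chart_val (tag u) p.
  move=> up vp; rewrite /f asboolT; last by exists (pj p).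
  by apply: chart_diffP; exact/tagP.
have cf : cocycle1 f.
  apply/asboolP; split=> [u v e|u v w [z [[uz vz] wz]]].
    by rewrite /f asboolF // e => -[].
  have [p ep] := proj_tiling_surj z; rewrite ep in uz vz wz.
  by rewrite !(fE _ _ p) //; ring.
exists (@dirlim_pi (cech_dirsys Omega) U (cech_class (CechZ1 cf))).
exists U, (CechZ1 cf), (fun u p => chart_val (tag u) p); split => //; split.
- move=> u p /tagP; case: (tag u) => [b|n] /=.
    by exists 0%N, 1.
  (* 1/6 is the distance from the threshold 1/2 to both 1/3 and 2/3. *)
  move=> h; exists 0%N, (1 / 6); split; first by lra.
  move=> q [_]; rewrite ltr_norml /= => l.
  case: h => -[h _]; first by rewrite !ifT //; lra.
  by rewrite !ifF //; apply/negbTE; rewrite -leNgt; lra.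
- by move=> u v p; exact: fE.
- move=> u p q /glueP[x [-> ->]] /tagP; case: (tag u) => [[]|n] /=.
  + by rewrite ltxx andbF.
  + by rewrite n1 andbF.
  + by rewrite n2 n3 n4 => -[[_ ->]|[//]]; rewrite subr0.
Qed.

(** * Trivializing a cocycle over the cylinder *)

Definition piece (n k : nat) (t : R) : Prop := k%:R / n.+1%:R <= t <= k.+1%:R / n.+1%:R.

Lemma piece_exists n t : 0 <= t <= 1 -> exists2 k, (k <= n)%N & piece n k t.
Proof.
move=> /andP[t0 t1].
suff H m : (m <= n)%N -> t <= m.+1%:R / n.+1%:R -> exists2 k, (k <= n)%N & piece n k t.
  by apply: (H n) => //; rewrite divff.
elim: m => [|m IH] mn ht; first by exists 0%N => //; rewrite /piece mul0r t0.
case: (lerP t (m.+1%:R / n.+1%:R)) => h; first exact: IH (ltnW mn) h.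
by exists m.+1 => //; rewrite /piece ht (ltW h).
Qed.

(** The pieces are closed and finite in number, so those missing [t] stay at a positive distance
    from it. *)
Lemma piece_near n t : exists e, 0 < e /\
  forall t', `|t - t'| < e -> forall k, (k <= n)%N -> piece n k t' -> piece n k t.
Proof.
suff H m : exists e, 0 < e /\ forall t', `|t - t'| < e ->
    forall k, (k < m)%N -> piece n k t' -> piece n k t.
  by have [e [e0 h]] := H n.+1; exists e; split.
elim: m => [|m [e [e0 IH]]]; first by exists 1.
suff [d [d0 hd]] : exists d, 0 < d /\ forall t', `|t - t'| < d -> piece n m t' -> piece n m t.
  exists (Num.min e d); split; first by rewrite lt_min e0.
  move=> t'; rewrite lt_min => /andP[l1 l2] k; rewrite ltnS leq_eqVlt.
  by move=> /orP[/eqP ->|km]; [exact: hd|exact: IH].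
rewrite /piece; move: (m%:R / n.+1%:R) (m.+1%:R / n.+1%:R) => a b.
case: (lerP a t) => h1; last first.
  exists (a - t); rewrite subr_gt0; split => // t'.
  by rewrite ltr_norml => l /andP[h _]; exfalso; lra.
case: (lerP t b) => h2; first by exists 1.
exists (t - b); rewrite subr_gt0; split => // t'.
by rewrite ltr_norml => l /andP[_ h]; exfalso; lra.
Qed.

Lemma piece_adjacent n k k' t : (k < k')%N -> piece n k t -> piece n k' t -> k' = k.+1.
Proof.
move=> kk /andP[_ h] /andP[h' _]; have := le_trans h' h.
rewrite ler_pM2r ?invr_gt0 ?ltr0n // ler_nat; lia.
Qed.

Section OneCocycle.
Context (U : open_cover Omega) (f : cech_Z1 U).

Definition good (n : nat) (C : set X) : Prop := forall k, (k <= n)%N ->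
  exists u : member U, forall y (t : set_type `[0 : R, 1]),
    C y -> piece n k (\val t) -> mem_set_of u (pj (y, t)).

Definition cyl n (x : X) : set X := [set y | agreeX n x y].

Lemma cyl_eq n x y : agreeX n x y -> cyl n x = cyl n y.
Proof.
move=> h; apply/seteqP; split=> z hz; first exact: agreeX_trans (agreeX_sym h) hz.
exact: agreeX_trans h hz.
Qed.

(** A tube argument: the same [n] serves as radius of the cylinder and as mesh. [K] is applied at
    the left end of each piece, whose length is exactly the tolerance. *)
Lemma good_exists x : exists n, `[< good n (cyl n x) >].
Proof.
pose K (n : nat) (t : R) := exists u : member U, forall y (t' : set_type `[0 : R, 1]),
  agreeX n x y -> `|t - \val t'| <= n.+1%:R^-1 -> mem_set_of u (pj (y, t')).
have [n hn] : exists n, forall t, 0 <= t <= 1 -> K n t.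
  apply: lebesgue_unit => t ht.
  have [u up] := cover_member U (pj (x, unit_point ht)).
  have [r [e [e0 he]]] := member_close up.
  have [N hN] := inv_small (divr_gt0 e0 (ltr0n _ 2)).
  exists (e / 2), (maxn r N); split; first by rewrite divr_gt0.
  move=> n t' hn tt; exists u => y b ag tb; apply: he; split => /=.
    by apply: agreeX_le ag; exact: leq_trans (leq_maxl _ _) hn.
  apply: le_lt_trans (ler_distD t' t (\val b)) _.
  rewrite [e]splitr ltrD // (le_lt_trans tb) // hN //.
  exact: leq_trans (leq_maxr _ _) hn.
exists n; apply/asboolP => k kn.
have [u hu] := hn _ (frac_unit (leqW kn)); exists u => y t ag /andP[l1 l2].
apply: hu => //; rewrite distrC ger0_norm ?subr_ge0 //.
rewrite lerBlDr; apply: le_trans l2 _.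
by rewrite -natr1 mulrDl mul1r addrC.
Qed.

(** The least [n] is taken because it depends only on the cylinders around [x], which makes it
    locally constant. *)
Definition depth x : nat := ex_minn (good_exists x).

Lemma depth_good x : good (depth x) (cyl (depth x) x).
Proof. by rewrite /depth; case: ex_minnP => n /asboolP. Qed.

Lemma depth_eq x y : agreeX (depth x) x y -> depth y = depth x.
Proof.
move=> h; have gE n : (n <= depth x)%N -> good n (cyl n x) <-> good n (cyl n y).
  by move=> hn; rewrite (cyl_eq (agreeX_le hn h)).
have le1 : (depth y <= depth x)%N.
  rewrite {1}/depth; case: ex_minnP => m _; apply; apply/asboolP/gE => //.
  exact: depth_good.
apply/eqP; rewrite eqn_leq le1 {1}/depth; case: ex_minnP => m _; apply.
by apply/asboolP/gE => //; exact: depth_good.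
Qed.

(** Members are chosen for triples of depth, cylinder and piece rather than for points, so that the
    choice is constant on cylinders. *)
Lemma lifting_charts : inhabited X -> exists G : X -> nat -> member U,
  (forall x y, agreeX (depth x) x y -> G y = G x) /\
  (forall x k (t : set_type `[0 : R, 1]), (k <= depth x)%N ->
    piece (depth x) k (\val t) -> mem_set_of (G x k) (pj (x, t))).
Proof.
move=> [x0]; have [u0 _] := cover_member U (pj (x0, J0)).
have ex (p : nat * set X * nat) : exists u : member U,
    good p.1.1 p.1.2 -> (p.2 <= p.1.1)%N -> forall y (t : set_type `[0 : R, 1]),
    p.1.2 y -> piece p.1.1 p.2 (\val t) -> mem_set_of u (pj (y, t)).
  have [g|ng] := pselect (good p.1.1 p.1.2); last by exists u0.
  case: (leqP p.2 p.1.1) => [l|//]; last by exists u0.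
  by have [u hu] := g _ l; exists u.
have [G hG] := choice ex.
exists (fun x k => G (depth x, cyl (depth x) x, k)); split.
  by move=> x y h; rewrite (depth_eq h) (cyl_eq h).
move=> x k t kx hp; apply: (hG (depth x, cyl (depth x) x, k)) => //.
exact: depth_good.
Qed.

(** The primitive is obtained by adding up the cocycle along the chain of members that covers the
    segment above a point, then passing from the last one to [u]. At an endpoint shared by two
    pieces the cocycle identity makes both sums agree, so any choice of [idx] works. *)
Lemma trivializes_exists : exists (h : member U -> S -> int) (phi : X -> int),
  loc_const phi /\ trivializes f h phi.
Proof.
(* If [X] is empty, the cover may have no member to choose, and all conditions are vacuous. *)
have [inh|ninh] := pselect (inhabited X); last first.
  exists (fun _ _ => 0), (fun=> 0); split; first by move=> x; case: ninh.
  by split=> [u [x t]|u v [x t]|u [x t]]; case: ninh.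
have [G [Gc Gm]] := lifting_charts inh.
pose H x k : int := \sum_(j < k) cech_Z1_val f (G x j) (G x j.+1).
have [idx hidx] := choice (fun p : S =>
  let: ex_intro2 k a b := piece_exists (depth p.1) (unit_pointP p.2) in
  ex_intro (fun k => (k <= depth p.1)%N /\ piece (depth p.1) k (\val p.2)) k (conj a b)).
pose hk u (p : S) k := H p.1 k + cech_Z1_val f (G p.1 k) u.
have hk_lt u p k k' : mem_set_of u (pj p) -> (k < k')%N -> (k' <= depth p.1)%N ->
    piece (depth p.1) k (\val p.2) -> piece (depth p.1) k' (\val p.2) ->
    hk u p k = hk u p k'.
  move=> up kk kd pk pk'; have e := piece_adjacent kk pk pk'; subst k'.
  rewrite /hk /H big_ord_recr /= -addrA; congr (_ + _).
  case: p up kd pk pk' {kk} => x t /= up kd pk pk'.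
  apply: (cech_Z1_cocycle f _ _ up); apply: Gm => //; exact: ltnW.
have hkE u p k k' : mem_set_of u (pj p) -> (k <= depth p.1)%N -> (k' <= depth p.1)%N ->
    piece (depth p.1) k (\val p.2) -> piece (depth p.1) k' (\val p.2) ->
    hk u p k = hk u p k'.
  move=> up l l' pk pk'; case: (ltngtP k k') => [kk|kk|-> //].
    exact: hk_lt.
  by symmetry; exact: hk_lt.
pose h u p := hk u p (idx p).
have T1 u p : mem_set_of u (pj p) -> loc_const_at (h u) p.
  move=> up; have [e [e0 he]] := piece_near (depth p.1) (\val p.2).
  exists (depth p.1), e; split => // q [ag l].
  have [i1 i2] := hidx p; have [j1 j2] := hidx q.
  have dq := depth_eq ag; rewrite dq in j1 j2.
  have -> : h u q = hk u p (idx q) by rewrite /h /hk /H (Gc _ _ ag).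
  by apply: hkE => //; exact: he j2.
have T2 u v p : mem_set_of u (pj p) -> mem_set_of v (pj p) ->
    cech_Z1_val f u v = h v p - h u p.
  move=> up vp; rewrite /h /hk; have [i1 i2] := hidx p.
  have gp : mem_set_of (G p.1 (idx p)) (pj p).
    by case: p {up vp} i1 i2 => x t /=; exact: Gm.
  by rewrite (cech_Z1_cocycle f gp up vp); ring.
have gl x : pj (x, J1) = pj (sigma_shift x, J0).
  by apply: proj_tiling_glue; apply/glueP; exists x.
have [m hm] := choice (fun x => cover_member U (pj (x, J1))).
pose phi x := h (m x) (x, J1) - h (m x) (sigma_shift x, J0).
have phiE u x : mem_set_of u (pj (x, J1)) ->
    phi x = h u (x, J1) - h u (sigma_shift x, J0).
  move=> ux; have e1 := T2 _ _ _ (hm x) ux.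
  have := T2 (m x) u (sigma_shift x, J0); rewrite -gl => /(_ (hm x) ux).
  by rewrite e1 /phi => /eqP; rewrite subr_eq => /eqP ->; ring.
exists h, phi; split; last first.
  by split=> // u p q /glueP[x [-> ->]] ux; exact: phiE.
move=> x; have [r1 [e1 [p1 c1]]] := T1 _ _ (hm x).
have hm' : mem_set_of (m x) (pj (sigma_shift x, J0)) by rewrite -gl.
have [r2 [e2 [p2 c2]]] := T1 _ _ hm'; have [r3 [e3 [p3 c3]]] := member_close (hm x).
exists (r1 + r2 + r3).+1 => y ag.
rewrite (phiE (m x) y); last first.
  by apply: c3; split => /=; [apply: agreeX_le ag; lia|rewrite subrr normr0].
rewrite /phi (c1 (y, J1)); last by split => /=; [apply: agreeX_le ag; lia|rewrite subrr normr0].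
rewrite (c2 (sigma_shift y, J0)) //; split => /=; last by rewrite subrr normr0.
by apply: agreeX_le (shift_agree ag); lia.
Qed.

End OneCocycle.

Lemma cech_represents_total (c : cech_H1 Omega) :
  exists2 phi, loc_const phi & cech_represents phi c.
Proof.
have [U [x ->]] := dirlim_surj c.
have [h [phi [hphi t]]] := trivializes_exists (repr (x : cech_H1_cover U)).
exists phi => //; exists U, (repr (x : cech_H1_cover U)), h; split => //.
by rewrite cech_class_repr.
Qed.

End Suspension.

(** Two elements related to the same one have a difference related to 0, so the kernel conditions
    make the relation single-valued in both directions. *)
Lemma zmod_isomorphic_relation (G H : zmodType) (rel : G -> H -> Prop) :
  (forall g h g' h', rel g h -> rel g' h' -> rel (g - g') (h - h')) ->
  (forall g, exists h, rel g h) -> (forall h, exists g, rel g h) ->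
  (forall h, rel 0 h -> h = 0) -> (forall g, rel g 0 -> g = 0) ->
  zmod_isomorphic G H.
Proof.
move=> relB totl totr rel0l rel0r.
have [f hf] := choice totl; have [k hk] := choice totr.
have fE g h : rel g h -> f g = h.
  by move=> r; apply/eqP; rewrite -subr_eq0; apply/eqP/rel0l;
    rewrite -(subrr g); exact: relB.
have kE g h : rel g h -> k h = g.
  by move=> r; apply/eqP; rewrite -subr_eq0; apply/eqP/rel0r;
    rewrite -(subrr h); exact: relB.
have fB : zmod_morphism f by move=> x y; apply: fE; exact: relB.
pose m := GRing.isZmodMorphism.Build G H f fB.
pose fa : {additive G -> H} := HB.pack f m.
by exists fa; exists k => x; [exact: kE|exact: fE].
Qed.

Theorem theorem4p6 (R : realType) (alpha : padic_int 3) (eps : nat -> 'I_3)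
    (halpha : padic_expansion alpha eps) (hnd : ~ degenerate eps) :
  zmod_isomorphic (cech_H1 (tiling_space R psi eps)) (G_alpha eps * int)%type.
Proof.
(* A cohomology class and an element of the limit correspond when one locally constant function
   describes both. *)
pose rel (c : cech_H1 (tiling_space R psi eps)) (h : G_alpha eps * int) :=
  exists phi, [/\ loc_const phi, cech_represents phi c & represents phi h].
apply: (zmod_isomorphic_relation (rel := rel)).
- move=> c h c' h' [phi [lc rc rh]] [phi' [lc' rc' rh']].
  exists (fun x => phi x - phi' x); split.
  + exact: (loc_const2 (fun a b => a - b)).
  + exact: cech_representsB.
  + exact: (representsB hnd).
- move=> c; have [phi lc rc] := cech_represents_total c.
  by have [h rh] := represents_total hnd lc; exists h, phi.
- move=> h; have [phi lc rh] := represents_surj h.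
  by have [c rc] := cech_represents_surj R lc; exists c, phi.
- move=> h [phi [_ /cech_represents0 rc rh]].
  exact: represents_cohom0 rc rh.
- move=> c [phi [_ rc /(represents0 hnd) rh]].
  exact: cech_represents_cohom0 rh rc.
Qed.
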